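(* Let $(\lambda,u)$ be an exact eigenpair, i.e. $u\in V$, $a(u,u)=1$ and $a(u,v)=\lambda b(u,v)$ for all $v\in V$. Assume the discrete eigenpair $(\bar\lambda_{i,h},\bar u_{i,h})$ has the property that $\bar\mu_{i,h}=1/\bar\lambda_{i,h}$ is the closest to $\mu=1/\lambda$ among the $\bar\mu_{j,h}$, $1\le j\le N_h$. Define the spectral projector $E_{i,h}:V_h\to{\rm span}\{\bar u_{i,h}\}$ by $a_h(E_{i,h}w,\bar u_{i,h})=a_h(w,\bar u_{i,h})$ for $w\in V_h$, and let $$\delta_{\lambda,h}=\min_{j\ne i}|\bar\mu_{j,h}-\mu|=\min_{j\ne i}\left|\frac1{\bar\lambda_{j,h}}-\frac1\lambda\right|,$$ assumed to be positive. Then $$\left\|Q_hu-E_{i,h}Q_hu\right\|_{a,h}\le2\|Q_hu-\mathcal P_hu\|_{a,h}+\frac{\sqrt{\bar\mu_{1,h}}}{\delta_{\lambda,h}}\left\|Q_hu-\mathcal P_hu\right\|_{b,h}$$ and $$\|Q_hu-E_{i,h}Q_hu\|_{b,h}\le\left(2+\frac{\bar\mu_{1,h}}{\delta_{\lambda,h}}\right)\left\|Q_hu-\mathcal P_hu\right\|_{b,h}.$$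
   Context: Setting. $\Omega\subset\mathbb R^d$ ($d=2,3$) is a convex bounded polygonal or polyhedral domain, $A\in[L^\infty(\Omega)]^{d\times d}$ is symmetric and satisfies $c\,\xi^T\xi\le\xi^TA(x)\xi\le C\,\xi^T\xi$ for all $\xi\in\mathbb R^d$, $x\in\Omega$, with positive constants $c,C$. $V=H_0^1(\Omega)$, $a(u,v)=(A\nabla u,\nabla v)$, $b(u,v)=(u,v)$. Weak Galerkin (WG) space. $\mathcal T_h$ is a shape-regular, quasi-uniform mesh of $\Omega$ by triangles/tetrahedra with edges/faces $\mathcal E_h$ and mesh size $h$. Fix an integer $r\ge 0$ and $t\in\{r,r+1\}$. $V_h$ is the space of $v=\{v_0,v_b\}$ with $v_0|_K\in\mathcal P_r(K)$ for each $K\in\mathcal T_h$, $v_b|_e\in\mathcal P_t(e)$ (single-valued) for each $e\in\mathcal E_h$, and $v_b|_e=0$ for $e\subset\partial\Omega$; no continuity between $v_0$ and $v_b$ is required. Set $G_r(K)=[\mathcal P_r(K)]^d+\widehat{\mathcal P}_r(K)\mathbf x$ if $t=r$ (Raviart-Thomas), with $\widehat{\mathcal P}_r(K)$ the homogeneous polynomials of degree $r$, and $G_r(K)=[\mathcal P_{r+1}(K)]^d$ if $t=r+1$ (BDM). The discrete weak gradient $\nabla_w v$ of $v\in V_h$ is defined on each $K$ by $\nabla_wv|_K\in G_r(K)$ and $(\nabla_wv,\mathbf q)_K=-(v_0,\nabla\cdot\mathbf q)_K+\langle v_b,\mathbf q\cdot\mathbf n\rangle_{\partial K}$ for all $\mathbf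 q\in G_r(K)$. Put $a_h(u,v)=\sum_{K}(A\nabla_wu,\nabla_wv)_K$, $b_h(u,v)=\sum_K(u_0,v_0)_K$, $\|v\|_{a,h}=\sqrt{a_h(v,v)}$, $\|v\|_{b,h}=\sqrt{b_h(v,v)}$; for $u\in L^2(\Omega)$, $b_h(u,v)=(u,v_0)_{L^2(\Omega)}$. Operators. $Q_hv=\{Q_0v,Q_bv\}\in V_h$ for $v\in V$, where $Q_0$ is the elementwise $L^2$ projection onto $\mathcal P_r(K)$ and $Q_b$ the $L^2$ projection onto $\mathcal P_t(e)$ on each edge/face. For an exact eigenpair $(\lambda,u)$, $\mathcal P_hu\in V_h$ is defined by $a_h(\mathcal P_hu,v_h)=\lambda b_h(u,v_h)$ for all $v_h\in V_h$. Discrete eigenvalue problem. The WG eigenpairs satisfy $a_h(\bar u_h,v_h)=\bar\lambda_hb_h(\bar u_h,v_h)$ for all $v_h\in V_h$, ordered $0<\bar\lambda_{1,h}\le\cdots\le\bar\lambda_{N_h,h}$, $N_h=\dim V_h$, with eigenfunctions satisfying $a_h(\bar u_{i,h},\bar u_{j,h})=\delta_{ij}$, and $\bar\mu_{j,h}=1/\bar\lambda_{j,h}$. Since $b_h$ is only positive semidefinite on $V_h$, eigenpairs are understood in the form $b_h(\bar u,v)=\bar\mu\,a_h(\bar u,v)$ with $\bar\lambda=1/\bar\mu$, where $\bar\lambda=+\infty$ and $1/\bar\lambda=0$ if $\bar\mu=0$. *)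

(* Defs.v *)
From HB Require Import structures.
From mathcomp Require Import all_boot all_order all_algebra.
From mathcomp Require Import all_classical all_reals all_analysis.
Set Implicit Arguments.
Unset Strict Implicit.
Unset Printing Implicit Defensive.
Import Order.TTheory GRing.Theory Num.Theory numFieldNormedType.Exports.
Local Open Scope classical_set_scope.
Local Open Scope ring_scope.

Definition row_display : measure_display -> measure_display.
Proof. exact. Qed.

Section row_measurable.
Context {d : measure_display} {T : sigmaRingType d} (n : nat).

Let coord (i : 'I_n) (x : 'rV[T]_n) : T := x ord0 i.

Let row_set0 : g_sigma_preimage coord set0.
Proof. exact: sigma_algebra0. Qed.

Let row_setC A : g_sigma_preimage coord A -> g_sigma_preimage coord (~` A).
Proof. exact: sigma_algebraC. Qed.

Let row_bigcup (F : _^nat) : (forall i, g_sigma_preimage coord (F i)) ->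
  g_sigma_preimage coord (\bigcup_i (F i)).
Proof. exact: sigma_algebra_bigcup. Qed.

HB.instance Definition _ := @isMeasurable.Build (row_display d)
  'rV[T]_n (g_sigma_preimage coord) row_set0 row_setC row_bigcup.

End row_measurable.

Lemma measurable_coord d (T : sigmaRingType d) n (i : 'I_n) :
  measurable_fun [set: 'rV[T]_n] (fun x => x ord0 i).
Proof.
move=> _ Y mY; rewrite setTI; apply: sub_sigma_algebra => /=.
rewrite -bigcup_seq/=; exists i => /=; first by rewrite mem_index_enum.
by exists Y => //; rewrite setTI.
Qed.

Lemma measurable_row d1 d2 (T1 : measurableType d1) (T2 : measurableType d2)
    n (f : T1 -> 'rV[T2]_n) :
  (forall i, measurable_fun setT (fun x => f x ord0 i)) ->
  measurable_fun setT f.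
Proof.
move=> mf _ A mA; rewrite setTI.
suff: measurable `<=` [set B : set 'rV[T2]_n | measurable (f @^-1` B)].
  by exact.
apply: smallest_sub.
  split => /=.
  - by rewrite preimage_set0.
  - by move=> B mB; rewrite setTD preimage_setC; exact: measurableC.
  - by move=> F mF; rewrite preimage_bigcup; exact: bigcup_measurable.
move=> B0; rewrite -bigcup_seq /= => -[i _ [B mB <-]].
rewrite setTI -comp_preimage -[X in measurable X]setTI; exact: mf.
Qed.

Section lebesgue.
Context {R : realType}.

Section cons.
Variable n : nat.

(* 'rV_(1 + n) is convertible to 'rV_n.+1 *)
Definition row_cons (p : measurableTypeR R * 'rV[R]_n) : 'rV[R]_n.+1 :=
  row_mx (p.1%:M : 'M[R]_1) p.2.

Definition row_uncons (x : 'rV[R]_n.+1) : measurableTypeR R * 'rV[R]_n :=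
  (x ord0 ord0, \row_j x ord0 (lift ord0 j)).

Lemma row_consK : cancel row_cons row_uncons.
Proof.
move=> [t y]; rewrite /row_uncons /row_cons /=; congr (_, _).
  have -> : (ord0 : 'I_n.+1) = lshift n (ord0 : 'I_1) by exact: val_inj.
  by rewrite (row_mxEl (t%:M : 'M[R]_1) y) mxE eqxx.
apply/rowP => j; rewrite mxE.
have -> : lift ord0 j = rshift 1 j by exact: val_inj.
by rewrite (row_mxEr (t%:M : 'M[R]_1) y).
Qed.

Lemma row_cons_ord0 p : row_cons p ord0 ord0 = p.1.
Proof. by rewrite -[in RHS](row_consK p). Qed.

Lemma row_cons_lift p j : row_cons p ord0 (lift ord0 j) = p.2 ord0 j.
Proof. by rewrite -[in RHS](row_consK p) /= mxE. Qed.

Lemma measurable_row_cons : measurable_fun setT row_cons.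
Proof.
apply: measurable_row => i.
have [->|[j ->]] : i = ord0 \/ exists j, i = lift ord0 j.
  by case: (unliftP ord0 i) => [j ->|->]; [right; exists j|left].
- by rewrite (_ : (fun _ => _) = fst)//; apply/funext/row_cons_ord0.
- rewrite (_ : (fun _ => _) = (fun y : 'rV[R]_n => y ord0 j) \o snd).
    by apply: measurableT_comp => //; exact: measurable_coord.
  by apply/funext => p; exact: row_cons_lift.
Qed.

Lemma measurable_row_uncons : measurable_fun setT row_uncons.
Proof.
apply/measurable_fun_pairP; split; first exact: measurable_coord.
apply: measurable_row => i /=.
rewrite (_ : (fun _ => _) = fun x : 'rV[R]_n.+1 => x ord0 (lift ord0 i)).
  exact: measurable_coord.
by apply/funext => x /=; rewrite mxE.
Qed.

Section step.
Variable m : {sigma_finite_measure set 'rV[R]_n -> \bar R}.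

Definition lebesgue_step : set 'rV[R]_n.+1 -> \bar R :=
  pushforward (@lebesgue_measure R \x m)%E row_cons.

Let measurable_preimage A : measurable A -> measurable (row_cons @^-1` A).
Proof.
by move=> mA; rewrite -[X in measurable X]setTI; exact: measurable_row_cons.
Qed.

Let step0 : lebesgue_step set0 = 0%E.
Proof. by rewrite /lebesgue_step /pushforward preimage_set0 measure0. Qed.

Let step_ge0 A : (0 <= lebesgue_step A)%E.
Proof. by rewrite /lebesgue_step /pushforward measure_ge0. Qed.

Let step_sigma_additive : semi_sigma_additive lebesgue_step.
Proof.
move=> F mF tF mUF; rewrite /lebesgue_step /pushforward preimage_bigcup.
apply: measure_semi_sigma_additive.
- by move=> k; exact: measurable_preimage.
- apply/trivIsetP => /= i j _ _ ij; rewrite -preimage_setI.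
  by move/trivIsetP : tF => /(_ _ _ _ _ ij) ->//; rewrite preimage_set0.
- by rewrite -preimage_bigcup; exact: measurable_preimage.
Qed.

HB.instance Definition _ :=
  isMeasure.Build _ _ _ lebesgue_step step0 step_ge0 step_sigma_additive.

Let step_sigma_finite : sigma_finite setT lebesgue_step.
Proof.
have /sigma_finiteP[F [TF ndF Foo]] := sigma_finiteT (@lebesgue_measure R).
have /sigma_finiteP[G [TG ndG Goo]] := sigma_finiteT m.
exists (fun k => row_uncons @^-1` (F k `*` G k)).
  apply/esym; rewrite -subTset => x _.
  have [k _ Fk] : (\bigcup_k F k) (row_uncons x).1 by rewrite -TF.
  have [l _ Gl] : (\bigcup_k G k) (row_uncons x).2 by rewrite -TG.
  exists (maxn k l) => //; split.
    by move: Fk; exact/subsetPset/ndF/leq_maxl.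
  by move: Gl; exact/subsetPset/ndG/leq_maxr.
move=> k; have [mF Fk] := Foo k; have [mG Gk] := Goo k; split.
  by rewrite -[X in measurable X]setTI; apply: measurable_row_uncons => //;
    exact: measurableX.
rewrite /lebesgue_step /pushforward -comp_preimage.
rewrite (_ : row_uncons \o row_cons = id); last exact/funext/row_consK.
by rewrite preimage_id product_measure1E// lte_mul_pinfty// ge0_fin_numE.
Qed.

HB.instance Definition _ :=
  Measure_isSigmaFinite.Build _ _ _ lebesgue_step step_sigma_finite.

End step.
End cons.

Fixpoint lebesgue_rV (n : nat) : {sigma_finite_measure set 'rV[R]_n -> \bar R} :=
  match n with
  | 0 => \d_(0 : 'rV[R]_0)
  | n'.+1 => lebesgue_step (lebesgue_rV n')
  end.

Lemma lebesgue_rV_box n (B : 'I_n -> set (measurableTypeR R)) :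
  (forall i, measurable (B i)) ->
  lebesgue_rV n [set x | forall i, B i (x ord0 i)] =
  (\prod_(i < n) @lebesgue_measure R (B i))%E.
Proof.
elim: n B => [|n IHn] B mB.
  rewrite big_ord0 /= diracE mem_set//= => -[]//.
have mbox m (D : 'I_m -> set (measurableTypeR R)) : (forall i, measurable (D i)) ->
    measurable [set x : 'rV[R]_m | forall i, D i (x ord0 i)].
  move=> mD; have -> : [set x : 'rV[R]_m | forall i, D i (x ord0 i)] =
      \bigcap_(i in [set: 'I_m]) ((fun x : 'rV[R]_m => x ord0 i) @^-1` D i).
    by apply/seteqP; split => x /= xD i; [move=> _; exact: xD|exact: (xD i I)].
  apply: fin_bigcap_measurable => // k _.
  rewrite -[X in measurable X]setTI; apply: (@measurable_coord _ R m k) => //.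
  exact: mD.
rewrite big_ord_recl -IHn//= /lebesgue_step /pushforward.
rewrite -product_measure1E//;
  last by apply: (mbox n (fun i => B (lift ord0 i))) => i; exact: mB.
congr (_ _); apply/seteqP; split => -[s y] /=.
  move=> sy; split => [|k].
    by have := sy ord0; rewrite row_cons_ord0.
  by have := sy (lift ord0 k); rewrite row_cons_lift.
move=> [sB yB] k; case: (unliftP ord0 k) => [l ->|->].
  by rewrite row_cons_lift; exact: yB.
by rewrite row_cons_ord0.
Qed.

End lebesgue.

Section Sobolev.
Context {R : realType} {d : nat}.
Implicit Types (Omega : set 'rV[R]_d) (f g : 'rV[R]_d -> R).

Definition dot (x y : 'rV[R]_d) : R := \sum_(i < d) x ord0 i * y ord0 i.

(* the library norm on 'rV[R]_d is the sup norm *)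
Definition enorm (x : 'rV[R]_d) : R := Num.sqrt (dot x x).

Definition boundary Omega : set 'rV[R]_d := closure Omega `\` interior Omega.

Definition convex_polyhedral_domain Omega : Prop :=
  [/\ Omega !=set0, open Omega, convex_set Omega, bounded_set Omega &
      exists (m : nat) (a : 'I_m -> 'rV[R]_d) (b : 'I_m -> R),
        (forall k, a k != 0) /\
        boundary Omega `<=` \bigcup_k [set x | dot (a k) x = b k]].

(* Vectors are rows, so M *m xi is written xi *m M^T. *)
Definition elliptic_coefficient Omega (A : 'rV[R]_d -> 'M[R]_d) (c C : R) :
    Prop :=
  [/\ forall i j, ((fun x => A x i j) \_ Omega) \in Lfun (lebesgue_rV d) +oo%E,
      forall x, Omega x -> (A x)^T = A x &
      forall x (xi : 'rV[R]_d), Omega x ->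
        c * dot xi xi <= dot (xi *m (A x)^T) xi <= C * dot xi xi].

Definition L2 Omega f : Prop := (f \_ Omega) \in Lfun (lebesgue_rV d) 2%:E.

Definition L2norm Omega f : \bar R :=
  'N[lebesgue_rV d]_(2%:E)[EFin \o (f \_ Omega)]%E.

Definition partial (i : 'I_d) f : 'rV[R]_d -> R :=
  fun x => 'D_(delta_mx ord0 i) f x.

Definition smooth f : Prop := forall s : seq 'I_d,
  let g := foldr partial f s in
  continuous g /\ forall i x, derivable g x (delta_mx ord0 i).

Definition test_function Omega f : Prop :=
  smooth f /\ exists K, [/\ compact K, K `<=` Omega & forall x, ~ K x -> f x = 0].

Definition distributional_gradient Omega f (Df : 'rV[R]_d -> 'rV[R]_d) : Prop :=
  forall phi (i : 'I_d), test_function Omega phi ->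
    \int[lebesgue_rV d]_(x in Omega) (f x * partial i phi x) =
    - \int[lebesgue_rV d]_(x in Omega) (Df x ord0 i * phi x).

Definition H1_function Omega f (Df : 'rV[R]_d -> 'rV[R]_d) : Prop :=
  [/\ L2 Omega f, forall i, L2 Omega (fun x => Df x ord0 i) &
      distributional_gradient Omega f Df].

Definition H1_limit Omega (phi : nat -> 'rV[R]_d -> R) f
    (Df : 'rV[R]_d -> 'rV[R]_d) : Prop :=
  (L2norm Omega (fun x => phi k x - f x) @[k --> \oo] --> 0%E) /\
  forall i, L2norm Omega (fun x => partial i (phi k) x - Df x ord0 i)
              @[k --> \oo] --> 0%E.

(* A representative of an element of H^1_0(Omega), the closure of the test
   functions in H^1(Omega), together with its weak gradient. *)
Record H10 Omega := MkH10 {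
  H10_fun :> 'rV[R]_d -> R;
  grad : 'rV[R]_d -> 'rV[R]_d;
  H10_H1 : H1_function Omega H10_fun grad;
  H10_closure : exists phi : nat -> 'rV[R]_d -> R,
    (forall k, test_function Omega (phi k)) /\ H1_limit Omega phi H10_fun grad
}.

Definition a_form Omega (A : 'rV[R]_d -> 'M[R]_d) (u v : H10 Omega) : R :=
  \int[lebesgue_rV d]_(x in Omega) dot (grad u x *m (A x)^T) (grad v x).

Definition b_form Omega (u v : H10 Omega) : R :=
  \int[lebesgue_rV d]_(x in Omega) (u x * v x).

Definition exact_eigenpair Omega (A : 'rV[R]_d -> 'M[R]_d) (lambda : R)
    (u : H10 Omega) : Prop :=
  a_form A u u = 1 /\ forall v : H10 Omega, a_form A u v = lambda * b_form u v.

End Sobolev.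

Section Polynomials.
Context {R : realType} {d : nat}.

Definition mdegree k (alpha : {ffun 'I_d -> 'I_k.+1}) : nat :=
  (\sum_(i < d) alpha i)%N.

Definition monomial k (alpha : {ffun 'I_d -> 'I_k.+1}) (x : 'rV[R]_d) : R :=
  \prod_(i < d) x ord0 i ^+ alpha i.

Definition poly_le (k : nat) (p : 'rV[R]_d -> R) : Prop :=
  exists c : {ffun 'I_d -> 'I_k.+1} -> R,
    forall x, p x = \sum_(alpha | (mdegree alpha <= k)%N) c alpha * monomial alpha x.

Definition poly_homog (k : nat) (p : 'rV[R]_d -> R) : Prop :=
  exists c : {ffun 'I_d -> 'I_k.+1} -> R,
    forall x, p x = \sum_(alpha | mdegree alpha == k) c alpha * monomial alpha x.

Definition vec_poly_le (k : nat) (q : 'rV[R]_d -> 'rV[R]_d) : Prop :=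
  forall i, poly_le k (fun x => q x ord0 i).

Definition raviart_thomas (r : nat) (q : 'rV[R]_d -> 'rV[R]_d) : Prop :=
  exists p s, [/\ vec_poly_le r p, poly_homog r s &
                  forall x, q x = p x + s x *: x].

(* A polynomial field on a cell is identified with its unique polynomial
   extension to the whole space, so this space does not depend on the cell. *)
Definition G_space (r t : nat) (q : 'rV[R]_d -> 'rV[R]_d) : Prop :=
  if t == r then raviart_thomas r q else vec_poly_le r.+1 q.

Definition divergence (q : 'rV[R]_d -> 'rV[R]_d) (x : 'rV[R]_d) : R :=
  \sum_(i < d) partial i (fun y => q y ord0 i) x.

End Polynomials.

(* A cell, edge or face is the set of its vertices. *)
Record mesh (R : realType) (d : nat) := Mesh {
  nb_vertices : nat;
  vertex : 'I_nb_vertices -> 'rV[R]_d;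
  cells : {set {set 'I_nb_vertices}}
}.

Section Mesh.
Context {R : realType} {d : nat} (T : mesh R d).
Local Notation simplex := {set 'I_(nb_vertices T)}.
Local Notation vertex := (@vertex R d T).
Implicit Types (K F S : simplex) (Omega : set 'rV[R]_d).

Definition faces : {set simplex} :=
  [set F : simplex | (#|F| == d) && [exists K in cells T, F \subset K]].

Definition faces_of K : {set simplex} :=
  [set F : simplex | (#|F| == d) && (F \subset K)].

Definition affinely_independent S : Prop :=
  forall w : 'I_(nb_vertices T) -> R,
    \sum_(i in S) w i = 0 -> \sum_(i in S) w i *: vertex i = 0 ->
    forall i, i \in S -> w i = 0.

Definition closed_simplex S : set 'rV[R]_d :=
  [set x | exists w : 'I_(nb_vertices T) -> R,
    [/\ forall i, i \in S -> 0 <= w i, \sum_(i in S) w i = 1 &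
        x = \sum_(i in S) w i *: vertex i]].

Definition open_simplex S : set 'rV[R]_d :=
  [set x | exists w : 'I_(nb_vertices T) -> R,
    [/\ forall i, i \in S -> 0 < w i, \sum_(i in S) w i = 1 &
        x = \sum_(i in S) w i *: vertex i]].

Definition triangulation Omega : Prop :=
  [/\ forall K, K \in cells T -> #|K| = d.+1 /\ affinely_independent K,
      forall K, K \in cells T -> open_simplex K `<=` Omega,
      closure Omega = \bigcup_(K in [set` cells T]) closed_simplex K &
      forall K K', K \in cells T -> K' \in cells T ->
        closed_simplex K `&` closed_simplex K' = closed_simplex (K :&: K')].

Definition diameter K : R :=
  sup [set e | exists x y,
    [/\ closed_simplex K x, closed_simplex K y & e = enorm (x - y)]].

Definition inball_diameter K : R :=
  sup [set e | exists x rho,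
    [/\ 0 <= rho, [set y | enorm (y - x) <= rho] `<=` closed_simplex K &
        e = 2 * rho]].

Definition mesh_size : R := \big[Num.max/0]_(K in cells T) diameter K.

Definition shape_regular (sigma : R) : Prop :=
  forall K, K \in cells T -> diameter K <= sigma * inball_diameter K.

Definition quasi_uniform (tau : R) : Prop :=
  forall K, K \in cells T -> mesh_size <= tau * diameter K.

(* Affine parametrization of the (d-1)-simplex F by the reference simplex of
   R^(d-1), and its Jacobian, the square root of the Gram determinant. *)
Definition face_vertex F (k : nat) : 'rV[R]_d :=
  nth 0 [seq vertex i | i <- enum F] k.

Definition face_edge F (k : nat) : 'rV[R]_d :=
  face_vertex F k.+1 - face_vertex F 0.

Definition face_map F (s : 'rV[R]_d.-1) : 'rV[R]_d :=
  face_vertex F 0 + \sum_(k < d.-1) s ord0 k *: face_edge F k.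

Definition face_jacobian F : R :=
  Num.sqrt (\det (\matrix_(k < d.-1, l < d.-1) dot (face_edge F k) (face_edge F l))).

Definition reference_simplex : set 'rV[R]_d.-1 :=
  [set s | (forall k, 0 < s ord0 k) /\ \sum_(k < d.-1) s ord0 k < 1].

Definition face_integral F (f : 'rV[R]_d -> R) : R :=
  face_jacobian F *
  \int[lebesgue_rV d.-1]_(s in reference_simplex) f (face_map F s).

(* The parametrized L^2 norm is the L^2(F) norm up to a constant factor. *)
Definition L2_face F (f : 'rV[R]_d -> R) : Prop :=
  L2 reference_simplex (f \o face_map F).

Definition L2norm_face F (f : 'rV[R]_d -> R) : \bar R :=
  L2norm reference_simplex (f \o face_map F).

Definition outward_normal K F (nu : 'rV[R]_d) : Prop :=
  [/\ dot nu nu = 1,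
      forall i j, i \in F -> j \in F -> dot nu (vertex i - vertex j) = 0 &
      forall i k, i \in F -> k \in K :\: F -> dot nu (vertex k - vertex i) < 0].

Definition normal K F : 'rV[R]_d := xget 0 [set nu | outward_normal K F nu].

Definition cell_integral K (f : 'rV[R]_d -> R) : R :=
  \int[lebesgue_rV d]_(x in open_simplex K) f x.

Definition boundary_face Omega F : Prop := closed_simplex F `<=` boundary Omega.

(* Trace on F of u in H^1_0: the L^2(F) limit of the traces of test functions
   converging to u in H^1. *)
Definition trace Omega (u : H10 Omega) F (g : 'rV[R]_d -> R) : Prop :=
  L2_face F g /\
  exists phi : nat -> 'rV[R]_d -> R,
    [/\ forall k, test_function Omega (phi k), H1_limit Omega phi u (grad u) &
        L2norm_face F (fun x => phi k x - g x) @[k --> \oo] --> 0%E].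

End Mesh.

(* v = {v_0, v_b}, see Vh below *)
Definition wg_function (R : realType) (d : nat) : Type :=
  (('rV[R]_d -> R^o) * ('rV[R]_d -> R^o))%type.

HB.instance Definition _ R d := GRing.Lmodule.on (wg_function R d).

Definition interior_part R d (v : wg_function R d) : 'rV[R]_d -> R := v.1.
Definition boundary_part R d (v : wg_function R d) : 'rV[R]_d -> R := v.2.

Section WeakGalerkin.
Context {R : realType} {d : nat} (T : mesh R d) (Omega : set 'rV[R]_d).
Context (r t : nat).
Local Notation simplex := {set 'I_(nb_vertices T)}.
Implicit Types (v w : wg_function R d) (K F : simplex).

(* Open cells are pairwise disjoint, and so are relatively open faces, so v_0
   and v_b are single functions; they are normalized to vanish outside the union
   of the open cells, resp. of the relatively open faces. *)
Definition Vh : set (wg_function R d) := [set v |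
  [/\ forall K, K \in cells T -> exists2 p, poly_le r p &
        forall x, open_simplex K x -> interior_part v x = p x,
      forall x, (forall K, K \in cells T -> ~ open_simplex K x) ->
        interior_part v x = 0,
      forall F, F \in faces T -> exists2 p, poly_le t p &
        forall x, open_simplex F x -> boundary_part v x = p x,
      forall F, F \in faces T -> boundary_face Omega F ->
        forall x, open_simplex F x -> boundary_part v x = 0 &
      forall x, (forall F, F \in faces T -> ~ open_simplex F x) ->
        boundary_part v x = 0]].

Definition discrete_weak_gradient
    (gradw : wg_function R d -> simplex -> 'rV[R]_d -> 'rV[R]_d) : Prop :=
  forall v K, Vh v -> K \in cells T ->
    G_space r t (gradw v K) /\
    forall q, G_space r t q ->
      cell_integral K (fun x => dot (gradw v K x) (q x)) =
      - cell_integral K (fun x => interior_part v x * divergence q x) +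
      \sum_(F in faces_of K)
        face_integral F (fun x => boundary_part v x * dot (q x) (normal K F)).

Definition ah (gradw : wg_function R d -> simplex -> 'rV[R]_d -> 'rV[R]_d)
    (A : 'rV[R]_d -> 'M[R]_d) v w : R :=
  \sum_(K in cells T)
    cell_integral K (fun x => dot (gradw v K x *m (A x)^T) (gradw w K x)).

Definition bh v w : R :=
  \sum_(K in cells T)
    cell_integral K (fun x => interior_part v x * interior_part w x).

(* b_h(u, v) = (u, v_0) for u in L^2 *)
Definition bh_L2 (u : 'rV[R]_d -> R) v : R :=
  \int[lebesgue_rV d]_(x in Omega) (u x * interior_part v x).

Definition norm_ah gradw A v : R := Num.sqrt (ah gradw A v v).

Definition norm_bh v : R := Num.sqrt (bh v v).

Definition is_Qh (u : H10 Omega) (Qu : wg_function R d) : Prop :=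
  [/\ Vh Qu,
      forall K p, K \in cells T -> poly_le r p ->
        cell_integral K (fun x => interior_part Qu x * p x) =
        cell_integral K (fun x => u x * p x) &
      forall F, F \in faces T -> exists2 g, trace u F g &
        forall p, poly_le t p ->
          face_integral F (fun x => boundary_part Qu x * p x) =
          face_integral F (fun x => g x * p x)].

Definition is_Ph gradw A (lambda : R) (u : H10 Omega) (Pu : wg_function R d) :
    Prop :=
  Vh Pu /\ forall v, Vh v -> ah gradw A Pu v = lambda * bh_L2 u v.

(* All discrete eigenpairs, in the form b_h(ubar, v) = mubar a_h(ubar, v); in
   \bar R the inverse of 0 is +oo. *)
Definition discrete_eigenpairs gradw A (Nh : nat) (mubar : 'I_Nh -> R)
    (lambdabar : 'I_Nh -> \bar R) (ubar : 'I_Nh -> wg_function R d) : Prop :=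
  [/\ forall j, Vh (ubar j),
      forall j v, Vh v -> bh (ubar j) v = mubar j * ah gradw A (ubar j) v,
      forall j k, ah gradw A (ubar j) (ubar k) = (j == k)%:R,
      forall j, lambdabar j = ((mubar j)%:E^-1)%E &
      (forall j, (0 < lambdabar j)%E) /\
      (forall j k : 'I_Nh, (j <= k)%N -> (lambdabar j <= lambdabar k)%E)].

Definition spectral_projector gradw A (ubar_i : wg_function R d)
    (E : wg_function R d -> wg_function R d) : Prop :=
  forall w, Vh w ->
    (exists a : R, E w = a *: ubar_i) /\
    ah gradw A (E w) ubar_i = ah gradw A w ubar_i.

End WeakGalerkin.

Definition has_dimension (R : realType) (V : lmodType R) (S : set V) (n : nat) :
    Prop :=
  exists b : 'I_n -> V,
    [/\ forall j, S (b j),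
        forall a : 'I_n -> R, \sum_(j < n) a j *: b j = 0 -> forall j, a j = 0 &
        forall v, S v -> exists a : 'I_n -> R, v = \sum_(j < n) a j *: b j].

Definition is_minimum (R : realType) (S : set R) (m : R) : Prop :=
  S m /\ lbound S m.

(* Main.v *)
(* The discrete eigenfunctions form an a_h-orthonormal basis of V_h in which
   a_h(v, v) is the sum of the v_j^2 and b_h(v, v) the sum of the mu_j v_j^2.
   Writing q = Q_h u and p = P_h u, the definitions of P_h and of the L^2
   projection Q_0 give a_h(p, v) = lambda (u, v_0) = lambda b_h(q, v), that is
   p_j = lambda mu_j q_j, hence p_j = mu_j / (mu - mu_j) (q_j - p_j) with
   mu = 1 / lambda. For j != i the factor is at most mu_1 / delta, and both
   bounds follow from q_j = (q_j - p_j) + p_j coordinatewise. What has to be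
   checked on the concrete spaces is that a_h and b_h are symmetric and bilinear
   on V_h; the weak gradient being fixed only by integral identities, it is
   linear up to a null set of each cell. *)
Require Import Defs.
From mathcomp Require Import all_boot all_order all_algebra.
From mathcomp Require Import all_classical all_reals all_analysis.
From mathcomp Require Import measurable_realfun.
From mathcomp Require Import ring lra.
Set Implicit Arguments.
Unset Strict Implicit.
Unset Printing Implicit Defensive.
Import Order.TTheory GRing.Theory Num.Theory numFieldNormedType.Exports.
Local Open Scope classical_set_scope.
Local Open Scope ring_scope.

(** * Cauchy-Schwarz and Minkowski inequalities for finite sums of squares *)

Section WeightedNorm.
Context {R : realType} {I : finType} (P : pred I).
Implicit Types x y : I -> R.

(** After multiplication by the product [D * M] of the two norms this is Young's inequality term by
    term. The cases where a norm vanishes are separate, since [D * M] must be positive to be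
    cancelled. *)
Lemma sum_mul_le_sqrt x y :
  \sum_(i | P i) x i * y i <=
  Num.sqrt (\sum_(i | P i) x i ^+ 2) * Num.sqrt (\sum_(i | P i) y i ^+ 2).
Proof.
set X := \sum_(i | P i) x i ^+ 2; set Y := \sum_(i | P i) y i ^+ 2.
have X0 : 0 <= X by apply: sumr_ge0 => i _; exact: sqr_ge0.
have Y0 : 0 <= Y by apply: sumr_ge0 => i _; exact: sqr_ge0.
set D := Num.sqrt X; set M := Num.sqrt Y.
have DX : D ^+ 2 = X by rewrite sqr_sqrtr.
have MY : M ^+ 2 = Y by rewrite sqr_sqrtr.
have D0 : 0 <= D by exact: sqrtr_ge0.
have M0 : 0 <= M by exact: sqrtr_ge0.
have zero z : \sum_(i | P i) z i ^+ 2 = 0 :> R -> forall i, P i -> z i = 0.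
  move=> /eqP; rewrite psumr_eq0 => [/allP z0 i Pi|i _]; last exact: sqr_ge0.
  by have := z0 i (mem_index_enum _); rewrite Pi /= sqrf_eq0 => /eqP.
have [D00|Dn0] := eqVneq D 0.
  have X00 : X = 0 by rewrite -DX D00 expr0n.
  rewrite D00 mul0r big1// => i Pi.
  by rewrite (zero _ X00 _ Pi) mul0r.
have [M00|Mn0] := eqVneq M 0.
  have Y00 : Y = 0 by rewrite -MY M00 expr0n.
  rewrite M00 mulr0 big1// => i Pi.
  by rewrite (zero _ Y00 _ Pi) mulr0.
have DM0 : 0 < D * M by rewrite mulr_gt0 ?lt0r ?Dn0 ?Mn0.
rewrite -(ler_pM2l DM0) mulr_sumr.
(* The weights are crossed so that each of the two sums equals [D ^+ 2 * M ^+ 2]; the termwise gap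
   is then half of [(M * x i - D * y i) ^+ 2]. *)
have -> : D * M * (D * M) = \sum_(i | P i) (M ^+ 2 * x i ^+ 2 + D ^+ 2 * y i ^+ 2) / 2.
  by rewrite -mulr_suml big_split/= -!mulr_sumr -/X -/Y -DX -MY; field.
apply: ler_sum => i Pi.
have := sqr_ge0 (M * x i - D * y i).
nra.
Qed.

Lemma sqrt_sum_sqrD x y :
  Num.sqrt (\sum_(i | P i) (x i + y i) ^+ 2) <=
  Num.sqrt (\sum_(i | P i) x i ^+ 2) + Num.sqrt (\sum_(i | P i) y i ^+ 2).
Proof.
have s0 z : 0 <= \sum_(i | P i) z i ^+ 2 :> R.
  by apply: sumr_ge0 => i _; exact: sqr_ge0.
rewrite -(@ler_pXn2r _ 2)// ?nnegrE ?addr_ge0 ?sqrtr_ge0//.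
rewrite sqrrD !sqr_sqrtr//.
have xy := sum_mul_le_sqrt x y.
under eq_bigr do rewrite sqrrD.
rewrite !big_split/=; lra.
Qed.

End WeightedNorm.

(** * Orthonormal expansion in a subspace [S], for forms linear on [S] only *)

Section OrthonormalBasis.
Context {R : realType} {V : lmodType R} (S : set V) (a : V -> V -> R).
Hypothesis S0 : S 0.
Hypothesis SD : forall k x y, S x -> S y -> S (k *: x + y).
Hypothesis aD : forall k x y z, S x -> S y -> S z ->
  a (k *: x + y) z = k * a x z + a y z.

Lemma form0 (f : V -> V -> R) (fD : forall k x y z, S x -> S y -> S z ->
  f (k *: x + y) z = k * f x z + f y z) z : S z -> f 0 z = 0.
Proof.
move=> Sz; have := fD 1 0 0 z S0 S0 Sz; rewrite scale1r addr0 mul1r => /eqP.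
by rewrite -subr_eq0 opprD addrA subrr sub0r oppr_eq0 => /eqP.
Qed.

(** The form [f] is arbitrary because both the energy form and the mass form are expanded this
    way. *)
Lemma form_sum (f : V -> V -> R) (fD : forall k x y z, S x -> S y -> S z ->
  f (k *: x + y) z = k * f x z + f y z) (I : finType) (k : I -> R) (x : I -> V) z :
  (forall i, S (x i)) -> S z -> f (\sum_i k i *: x i) z = \sum_i k i * f (x i) z.
Proof.
(* As [f] is additive on [S] only, the induction carries membership of the partial sums in [S] along
   with their values. *)
move=> Sx Sz; pose K y s := S y /\ f y z = s.
suff [] : K (\sum_i k i *: x i) (\sum_i k i * f (x i) z) by [].
apply: (big_ind2 K) => [|y1 s1 y2 s2 [Sy1 <-] [Sy2 <-]|i _].
- by split => //; exact: form0.
- split; first by rewrite -[y1]scale1r; exact: SD.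
  by rewrite -[in LHS](scale1r y1) fD// mul1r.
- split; first by rewrite -[_ *: _]addr0; exact: SD.
  by rewrite -[k i *: x i]addr0 fD// form0// addr0.
Qed.

Context (n : nat) (u : 'I_n -> V).
Hypothesis Su : forall j, S (u j).
Hypothesis au : forall j k, a (u j) (u k) = (j == k)%:R.

Lemma form_sum_orthonormal (k : 'I_n -> R) j : a (\sum_i k i *: u i) (u j) = k j.
Proof.
rewrite (form_sum aD)// (bigD1 j)//= au eqxx mulr1 big1 ?addr0// => i /negPf ij.
by rewrite au ij mulr0.
Qed.

(** Orthonormal vectors are independent, so the matrix [M] expressing [n] of them in a basis of [n]
    elements is invertible, and they span [S] as well. *)
Lemma orthonormal_expansion (dimS : has_dimension S n) v :
  S v -> v = \sum_j a v (u j) *: u j.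
Proof.
move=> Sv; have [b [Sb bfree bspan]] := dimS.
pose coord j := sval (cid (bspan (u j) (Su j))).
have uE j : u j = \sum_k coord j k *: b k by rewrite /coord; case: cid.
pose M := \matrix_(j, k) coord j k.
have Mu : M \in unitmx.
  (* A row [c] of the left kernel of [M] gives a vanishing combination of the [u j], and pairing it
     with [u j] returns the coefficient [c ord0 j]. *)
  rewrite -row_free_unit -kermx_eq0; apply/eqP/row_matrixP => l; rewrite row0.
  set c := row l _; have cM : c *m M = 0.
    by apply/sub_kermxP; exact: row_sub.
  have c0 : \sum_j c ord0 j *: u j = 0.
    under eq_bigr do rewrite uE scaler_sumr.
    rewrite exchange_big big1// => k _.
    under eq_bigr do rewrite scalerA.
    rewrite -scaler_suml; have : (c *m M) ord0 k = 0 by rewrite cM mxE.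
    rewrite [LHS]mxE => cMk.
    rewrite (_ : \sum_j _ = 0) ?scale0r// -[RHS]cMk.
    by apply: eq_bigr => j _; congr (_ * _); rewrite mxE.
  apply/rowP => j; rewrite [RHS]mxE -(form_sum_orthonormal (c ord0)) c0.
  exact: (form0 aD).
have [k vE] := bspan v Sv.
(* The change of basis turns the coordinates of [v] in [b] into coordinates in [u]; orthonormality
   then identifies these with [a v (u j)]. *)
pose q := \row_j k j *m invmx M.
suff vE' : v = \sum_j q ord0 j *: u j.
  by rewrite [LHS]vE'; apply: eq_bigr => j _; rewrite vE' form_sum_orthonormal.
under eq_bigr do rewrite uE scaler_sumr.
rewrite exchange_big vE; apply: eq_bigr => l _.
under eq_bigr do rewrite scalerA.
rewrite -scaler_suml; congr (_ *: _).
have /rowP/(_ l) : \row_j k j = q *m M by rewrite mulmxKV.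
by rewrite !mxE => ->; apply: eq_bigr => j _; rewrite !mxE.
Qed.

End OrthonormalBasis.

(** * Both estimates for two abstract symmetric forms with a common eigenbasis *)

Section SpectralEstimate.
Context {R : realType} {V : lmodType R} (S : set V) (a b : V -> V -> R).
Hypothesis S0 : S 0.
Hypothesis SD : forall k x y, S x -> S y -> S (k *: x + y).
Hypothesis aD : forall k x y z, S x -> S y -> S z ->
  a (k *: x + y) z = k * a x z + a y z.
Hypothesis bD : forall k x y z, S x -> S y -> S z ->
  b (k *: x + y) z = k * b x z + b y z.
Hypothesis aC : forall x y, S x -> S y -> a x y = a y x.
Hypothesis bC : forall x y, S x -> S y -> b x y = b y x.
Context (n : nat) (u : 'I_n -> V) (mu : 'I_n -> R).
Hypothesis Su : forall j, S (u j).
Hypothesis au : forall j k, a (u j) (u k) = (j == k)%:R.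
Hypothesis bu : forall j v, S v -> b (u j) v = mu j * a (u j) v.
Hypothesis dimS : has_dimension S n.

Let expansion := orthonormal_expansion S0 SD aD Su au dimS.

(** Parseval's identity; [b_coord] is its weighted form, with the eigenvalues as weights. *)
Lemma a_coord v : S v -> a v v = \sum_j a v (u j) ^+ 2.
Proof.
move=> Sv; rewrite {1}(expansion Sv) (form_sum S0 SD aD)//.
by apply: eq_bigr => j _; rewrite aC// expr2.
Qed.

Lemma b_coord v : S v -> b v v = \sum_j mu j * a v (u j) ^+ 2.
Proof.
move=> Sv; rewrite {1}(expansion Sv) (form_sum S0 SD bD)//.
by apply: eq_bigr => j _; rewrite bu// (aC (Su j))// expr2 mulrCA.
Qed.

Context (lambda delta mu1 : R) (i : 'I_n) (q p e : V).
Hypothesis lambda0 : lambda != 0.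
Hypothesis delta0 : 0 < delta.
Hypothesis mu0 : forall j, 0 <= mu j.
Hypothesis mu_le : forall j, mu j <= mu1.
Hypothesis gap : forall j, j != i -> delta <= `|mu j - lambda^-1|.
Hypothesis Sq : S q.
Hypothesis Sp : S p.
Hypothesis pq : forall v, S v -> a p v = lambda * b q v.
Hypothesis eE : exists k, e = k *: u i.
Hypothesis ae : a e (u i) = a q (u i).

Let mu10 : 0 <= mu1.
Proof. exact: le_trans (mu0 i) (mu_le i). Qed.

Let coordB x y j : S x -> S y -> a (x - y) (u j) = a x (u j) - a y (u j).
Proof.
by move=> Sx Sy; rewrite addrC -scaleN1r aD// mulN1r addrC.
Qed.

Let SB x y : S x -> S y -> S (x - y).
Proof. by move=> Sx Sy; rewrite addrC -scaleN1r; exact: SD. Qed.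

Let Se : S e.
Proof. by have [k ->] := eE; rewrite -[_ *: _]addr0; exact: SD. Qed.

(** As [e] is the component of [q] along [u i], subtracting it deletes coordinate [i], the only one
    on which [gap] gives no control. *)
Let coord_e j : a (q - e) (u j) = if j == i then 0 else a q (u j).
Proof.
rewrite coordB//; case: eqVneq => [->|ji]; first by rewrite ae subrr.
have [k ->] := eE.
rewrite -[k *: _]addr0 aD// au eq_sym (negPf ji) mulr0 add0r.
by rewrite (form0 S0 aD)// subr0.
Qed.

(* In coordinates, [p_j = lambda mu_j q_j] gives [q_j = d_j + m_j d_j] for
   [d = q - p]. *)
Let d j := a (q - p) (u j).
Let m j := mu j / (lambda^-1 - mu j).

Let coord_q j : j != i -> a q (u j) = d j + m j * d j.
Proof.
(* Putting [lambda * mu j * q_j] for [p_j] in [q_j - p_j] leaves an identity in [q_j] alone, whose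
   denominators are nonzero by [gap]. *)
move=> ji; rewrite /d coordB// pq// bC// bu// (aC (Su j))//.
have g0 : lambda^-1 - mu j != 0.
  by rewrite -normr_gt0 distrC (lt_le_trans delta0)// gap.
have : 1 - lambda * mu j != 0.
  have -> : 1 - lambda * mu j = lambda * (lambda^-1 - mu j) by field.
  by rewrite mulf_neq0.
by rewrite /m => nz; field; rewrite lambda0 mulNr mulrC nz.
Qed.

Let m_le j : j != i -> `|m j| <= mu j / delta.
Proof.
move=> ji; rewrite /m normrM normfV ger0_norm// ler_wpM2l//.
have := gap ji; rewrite distrC => gj.
by rewrite lef_pV2 ?posrE// (lt_le_trans delta0).
Qed.

Let m_le1 j : j != i -> `|m j| <= mu1 / delta.
Proof.
by move=> ji; rewrite (le_trans (m_le ji))// ler_pM2r ?invr_gt0.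
Qed.

(** Minkowski's inequality separates [d j] from [m j * d j]. The first part is controlled by the
    [a]-norm of [q - p]. The second is controlled by its [b]-norm, since the bound on [m j ^+ 2]
    retains one factor [mu j], the weight in [b_coord]. *)
Lemma spectral_estimate_a :
  Num.sqrt (a (q - e) (q - e)) <=
  2 * Num.sqrt (a (q - p) (q - p)) +
  Num.sqrt mu1 / delta * Num.sqrt (b (q - p) (q - p)).
Proof.
have Sqp := SB Sq Sp; have Sqe := SB Sq Se.
rewrite (a_coord Sqe) (a_coord Sqp) (b_coord Sqp).
under eq_bigr do rewrite coord_e.
rewrite (bigD1 i)//= eqxx expr0n add0r.
under eq_bigr => j ji do rewrite (negPf ji) coord_q//.
apply: le_trans (sqrt_sum_sqrD _ _ _) _; apply: lerD.
  (* Restoring coordinate [i] can only increase the sum, and the factor 1 obtained is at most 2. *)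
  apply: (@le_trans _ _ (1 * Num.sqrt (\sum_j d j ^+ 2))).
    rewrite mul1r ler_wsqrtr// [leRHS](bigD1 i)//= lerDr; exact: sqr_ge0.
  by apply: ler_wpM2r; rewrite ?sqrtr_ge0// ler1n.
have -> : Num.sqrt mu1 / delta = Num.sqrt (mu1 / delta ^+ 2).
  rewrite sqrtrM// sqrtrV ?sqr_ge0// sqrtr_sqr gtr0_norm//.
rewrite -sqrtrM; last by rewrite divr_ge0// sqr_ge0.
rewrite ler_wsqrtr// mulr_sumr [leRHS](bigD1 i)//= ler_wpDl//.
  by rewrite mulr_ge0 ?divr_ge0 ?(mulr_ge0 (mu0 i)) ?sqr_ge0.
apply: ler_sum => j ji; rewrite exprMn [leRHS]mulrA ler_wpM2r ?sqr_ge0//.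
(* The two factors [|m j|] are bounded differently: one by [mu1 / delta], the other by
   [mu j / delta], which keeps the weight of [b]. *)
rewrite -[m j ^+ 2]real_normK ?num_real// expr2.
have -> : mu1 / delta ^+ 2 * mu j = (mu1 / delta) * (mu j / delta).
  by field; rewrite gt_eqF.
by apply: ler_pM => //; [exact: m_le1|exact: m_le].
Qed.

(** Both sides are diagonal with the same weights [mu j], so they compare coordinate by coordinate:
    coordinate [i] of [q - e] is zero, and elsewhere the factor is [1 + m j]. *)
Lemma spectral_estimate_b :
  Num.sqrt (b (q - e) (q - e)) <=
  (2 + mu1 / delta) * Num.sqrt (b (q - p) (q - p)).
Proof.
have Sqp := SB Sq Sp; have Sqe := SB Sq Se.
rewrite (b_coord Sqe) (b_coord Sqp).
have k0 : 0 <= 2 + mu1 / delta by rewrite addr_ge0 ?divr_ge0// ltW.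
rewrite -[X in X * _]ger0_norm// -sqrtr_sqr -sqrtrM ?sqr_ge0//.
rewrite ler_wsqrtr// mulr_sumr; apply: ler_sum => j _.
rewrite coord_e; case: eqVneq => [_|ji].
  by rewrite expr0n mulr0 mulr_ge0 ?(mulr_ge0 (mu0 j)) ?sqr_ge0.
rewrite [leRHS]mulrCA ler_wpM2l// coord_q// -/(d j).
rewrite -{1}[d j]mul1r -mulrDl exprMn ler_wpM2r ?sqr_ge0//.
rewrite -ler_sqrt ?sqr_ge0// !sqrtr_sqr [leRHS]ger0_norm//.
rewrite (le_trans (ler_normD _ _))// normr1 lerD ?m_le1// ler1n//.
Qed.

End SpectralEstimate.

(** * Bounded measurable functions and their integrability *)

Section BoundedMeasurable.
Context {disp : measure_display} {X : measurableType disp} {R : realType}.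
Implicit Types (D : set X) (f g : X -> R).

(** Unlike integrability, this property is stable under products, and it implies integrability on
    sets of finite measure. *)
Definition bounded_measurable D f :=
  measurable_fun D f /\ exists M, forall x, D x -> `|f x| <= M.

Lemma bounded_measurable_cst D (k : R) : bounded_measurable D (fun=> k).
Proof. by split; [exact: measurable_cst|exists `|k|]. Qed.

Lemma bounded_measurableD D f g : bounded_measurable D f ->
  bounded_measurable D g -> bounded_measurable D (fun x => f x + g x).
Proof.
move=> [mf [M fM]] [mg [N gN]]; split; first exact: measurable_funD.
by exists (M + N) => x Dx; rewrite (le_trans (ler_normD _ _))// lerD ?fM ?gN.
Qed.

Lemma bounded_measurableM D f g : bounded_measurable D f ->
  bounded_measurable D g -> bounded_measurable D (fun x => f x * g x).
Proof.
move=> [mf [M fM]] [mg [N gN]]; split; first exact: measurable_funM.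
by exists (M * N) => x Dx; rewrite normrM ler_pM ?fM ?gN.
Qed.

Lemma bounded_measurable_sum D (I : Type) (s : seq I) (P : pred I)
    (F : I -> X -> R) :
  (forall i, P i -> bounded_measurable D (F i)) ->
  bounded_measurable D (fun x => \sum_(i <- s | P i) F i x).
Proof.
move=> bF; elim: s => [|i s IHs].
  under eq_fun do rewrite big_nil; exact: bounded_measurable_cst.
under eq_fun do rewrite big_cons.
by case: (boolP (P i)) => // Pi; apply: bounded_measurableD => //; exact: bF.
Qed.

Lemma eq_bounded_measurable D f g : (forall x, D x -> f x = g x) ->
  bounded_measurable D f -> bounded_measurable D g.
Proof.
move=> fg [mf [M fM]]; split; last by exists M => x Dx; rewrite -fg// fM.
by apply: (@eq_measurable_fun _ _ _ _ D f g _ mf) => x /set_mem; exact: fg.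
Qed.

Context (mu : {measure set X -> \bar R}).

Lemma bounded_measurable_integrable D f : measurable D -> (mu D < +oo)%E ->
  bounded_measurable D f -> mu.-integrable D (EFin \o f).
Proof.
move=> mD muD [mf [M fM]]; apply: measurable_bounded_integrable => //.
exists M; split; first exact: num_real.
by move=> N MN x Dx; exact: le_trans (fM x Dx) (ltW MN).
Qed.

(* Obtained from [2 |f g| <= M (1 + f^2)], as [D] has finite measure. *)
Lemma square_integrableM D f g : measurable D -> (mu D < +oo)%E ->
  measurable_fun D f -> mu.-integrable D (EFin \o (fun x => f x ^+ 2)) ->
  bounded_measurable D g -> mu.-integrable D (EFin \o (fun x => f x * g x)).
Proof.
move=> mD muD mf f2 [mg [M gM]].
have i1 := bounded_measurable_integrable mD muD (bounded_measurable_cst D 1).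
(* The bound enters as [|M|] because [M] may be negative when [D] is empty. *)
have i2 : mu.-integrable D (EFin \o (fun x => `|M| * (1 + f x ^+ 2))).
  apply: (@eq_integrable _ _ _ _ _ mD
      (fun x => `|M|%:E * ((1%:E + (f x ^+ 2)%:E)))%E) => //.
  by apply: integrableZl => //; exact: integrableD.
apply: le_integrable i2 => //.
  by apply/measurable_EFinP; exact: measurable_funM.
move=> x Dx; rewrite /= lee_fin normrM mulrC [leRHS]normrM normr_id ler_pM//.
  by rewrite (le_trans (gM x Dx))// ler_norm.
rewrite [leRHS]ger0_norm ?addr_ge0 ?sqr_ge0//.
by rewrite -[f x ^+ 2]real_normK ?num_real//; nra.
Qed.

End BoundedMeasurable.

(** * Polynomial functions without record of the degree *)

Section PolynomialFunctions.
Context {R : realType} {d : nat}.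
Implicit Types p q : 'rV[R]_d -> R.

(** Forgetting degrees gives one class that contains the components of both kinds of [G_space]
    fields and is stable under products and partial derivatives. *)
Inductive polynomial_function : ('rV[R]_d -> R) -> Prop :=
| poly_cst k : polynomial_function (fun=> k)
| poly_coord i : polynomial_function (fun x => x ord0 i)
| poly_add p q : polynomial_function p -> polynomial_function q ->
    polynomial_function (fun x => p x + q x)
| poly_mul p q : polynomial_function p -> polynomial_function q ->
    polynomial_function (fun x => p x * q x).

Lemma polynomial_function_sum (I : Type) (s : seq I) (P : pred I)
    (F : I -> 'rV[R]_d -> R) : (forall i, P i -> polynomial_function (F i)) ->
  polynomial_function (fun x => \sum_(i <- s | P i) F i x).
Proof.
move=> pF; elim: s => [|i s IHs].
  by under eq_fun do rewrite big_nil; exact: poly_cst.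
under eq_fun do rewrite big_cons.
by case: (boolP (P i)) => // Pi; apply: poly_add => //; exact: pF.
Qed.

Lemma polynomial_function_prod (I : Type) (s : seq I) (P : pred I)
    (F : I -> 'rV[R]_d -> R) : (forall i, P i -> polynomial_function (F i)) ->
  polynomial_function (fun x => \prod_(i <- s | P i) F i x).
Proof.
move=> pF; elim: s => [|i s IHs].
  by under eq_fun do rewrite big_nil; exact: poly_cst.
under eq_fun do rewrite big_cons.
by case: (boolP (P i)) => // Pi; apply: poly_mul => //; exact: pF.
Qed.

Lemma polynomial_functionX p n : polynomial_function p ->
  polynomial_function (fun x => p x ^+ n).
Proof.
move=> pp; elim: n => [|n IHn]; first exact: poly_cst.
by under eq_fun do rewrite exprS; exact: poly_mul.
Qed.

Lemma polynomial_function_monomial k (alpha : {ffun 'I_d -> 'I_k.+1}) :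
  polynomial_function (monomial alpha).
Proof.
apply: polynomial_function_prod => i _; apply: polynomial_functionX.
exact: poly_coord.
Qed.

Lemma poly_le_polynomial_function k p : poly_le k p -> polynomial_function p.
Proof.
move=> [c pE]; rewrite (funext pE); apply: polynomial_function_sum => alpha _.
by apply: poly_mul; [exact: poly_cst|exact: polynomial_function_monomial].
Qed.

Lemma poly_homog_polynomial_function k p :
  poly_homog k p -> polynomial_function p.
Proof.
move=> [c pE]; rewrite (funext pE); apply: polynomial_function_sum => alpha _.
by apply: poly_mul; [exact: poly_cst|exact: polynomial_function_monomial].
Qed.

Lemma G_space_polynomial_function r t (q : 'rV[R]_d -> 'rV[R]_d) i : G_space r t q ->
  polynomial_function (fun x => (q x : 'rV[R]_d) ord0 i).
Proof.
rewrite /G_space; case: ifP => _; last by move=> /(_ i)/poly_le_polynomial_function.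
move=> [p [s [/(_ i)/poly_le_polynomial_function pp]]].
move=> /poly_homog_polynomial_function ps qE.
rewrite (_ : (fun _ => _) = fun x => p x ord0 i + s x * x ord0 i).
  by apply: poly_add => //; apply: poly_mul => //; exact: poly_coord.
by apply/funext => x; rewrite qE !mxE.
Qed.

Lemma is_derive_coord (i : 'I_d) (x v : 'rV[R]_d) :
  is_derive x v (fun y : 'rV[R]_d => y ord0 i : R^o) (v ord0 i : R^o).
Proof.
have H : (fun h : R => h^-1 *: (((fun y : 'rV[R]_d => y ord0 i : R^o) \o shift x) (h *: v)
    - x ord0 i : R^o)) @ 0^' --> (v ord0 i : R^o).
  (* The difference quotient of a coordinate is constant away from 0. *)
  apply: cvg_near_cst; near=> h.
  have h0 : h != 0 by near: h; exact: nbhs_dnbhs_neq.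
  by rewrite /= !mxE addrK /GRing.scale/= mulKf.
apply: DeriveDef; first by apply/cvg_ex; exists (v ord0 i).
exact: cvg_lim.
Unshelve. all: by end_near.
Qed.

Lemma polynomial_function_partial p i : polynomial_function p ->
  polynomial_function (partial i p).
Proof.
move=> pp; suff [Dp pDp DpE] : exists2 Dp : 'rV[R]_d -> R,
    polynomial_function Dp &
    forall x, is_derive x (delta_mx ord0 i) (p : 'rV[R]_d -> R^o) (Dp x : R^o).
  rewrite (_ : partial i p = Dp)//; apply/funext => x.
  by rewrite /partial; have := DpE x => H; rewrite derive_val.
elim: pp => [k|j|{}p q pp [Dp pDp DpE] pq [Dq pDq DqE]
  |{}p q pp [Dp pDp DpE] pq [Dq pDq DqE]].
- by exists (fun=> 0); [exact: poly_cst|move=> x; exact: is_derive_cst].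
- exists (fun=> (delta_mx ord0 i : 'rV[R]_d) ord0 j); first exact: poly_cst.
  by move=> x; exact: is_derive_coord.
- by exists (fun x => Dp x + Dq x); [exact: poly_add|move=> x; exact: is_deriveD].
- exists (fun x => p x * Dq x + q x * Dp x).
    by apply: poly_add; exact: poly_mul.
  by move=> x; exact: is_deriveM.
Qed.

Lemma polynomial_function_divergence r t (q : 'rV[R]_d -> 'rV[R]_d) : G_space r t q ->
  polynomial_function (divergence q : 'rV[R]_d -> R).
Proof.
move=> Gq; apply: polynomial_function_sum => i _.
by apply: polynomial_function_partial; exact: G_space_polynomial_function Gq.
Qed.

(** The map [h] is the identity for integrals over cells and [face_map] for integrals over faces. *)
Lemma bounded_measurable_polynomial {disp : measure_display}
    {Y : measurableType disp} (D : set Y) (h : Y -> 'rV[R]_d) p :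
  (forall i, bounded_measurable D (fun y => h y ord0 i)) ->
  polynomial_function p -> bounded_measurable D (p \o h).
Proof.
move=> bh; elim => [k|//|{}p q _ bp _ bq|{}p q _ bp _ bq].
- exact: bounded_measurable_cst.
- exact: bounded_measurableD.
- exact: bounded_measurableM.
Qed.

End PolynomialFunctions.

(** * Measurability and finiteness for Lebesgue measure on row vectors *)

Section LebesgueRows.
Context {R : realType} {n : nat}.

Lemma polynomial_function_measurable (p : 'rV[R]_n -> R) D :
  polynomial_function p -> measurable_fun D p.
Proof.
move=> pp; apply: (@measurable_funS _ _ _ _ setT) => //.
elim: pp => [k|i|{}p q _ mp _ mq|{}p q _ mp _ mq].
- exact: measurable_cst.
- exact: measurable_coord.
- exact: measurable_funD.
- exact: measurable_funM.
Qed.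

Lemma measurable_polynomial_gt0 (p : 'rV[R]_n -> R) :
  polynomial_function p -> measurable [set x | 0 < p x].
Proof.
move=> /(@polynomial_function_measurable _ setT) mp.
rewrite (_ : [set _ | _] = setT `&` p @^-1` `]0, +oo[%classic).
  exact: mp.
by apply/seteqP; split => x /=; rewrite in_itv/= andbT// => -[].
Qed.

Lemma measurable_forall (I : finType) (P : pred I) (F : I -> set 'rV[R]_n) :
  (forall i, P i -> measurable (F i)) ->
  measurable [set x | forall i, P i -> F i x].
Proof.
move=> mF; rewrite (_ : [set _ | _] = \bigcap_(i in [set i | P i]) F i).
  by apply: fin_bigcap_measurable => //; exact: finite_finset.
by apply/seteqP; split => x.
Qed.

(** The set lies in a cube, whose measure is a finite product of finite lengths. *)
Lemma lebesgue_rV_bounded (D : set 'rV[R]_n) (M : R) : measurable D ->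
  (forall x, D x -> forall i, `|x ord0 i| <= M) -> (lebesgue_rV n D < +oo)%E.
Proof.
move=> mD DM; pose B (i : 'I_n) : set (measurableTypeR R) := `[- M, M]%classic.
have mB i : measurable (B i) by exact: measurable_itv.
apply: (@le_lt_trans _ _ (lebesgue_rV n [set x | forall i, B i (x ord0 i)])).
  apply: le_measure; rewrite ?inE//.
    rewrite (_ : [set _ | _] = [set x | forall i, true -> B i (x ord0 i)]).
      apply: measurable_forall => i _; rewrite -[X in measurable X]setTI.
      by apply: (@measurable_coord _ (measurableTypeR R) n i) => //; exact: mB.
    by apply/seteqP; split => x /= H i //; exact: H.
  by move=> x /DM xM i; rewrite /B/= in_itv/= -ler_norml.
rewrite lebesgue_rV_box//.
suff /andP[] : (0 <= \prod_(i < n) lebesgue_measure (B i) < +oo)%E by [].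
apply: (big_ind (fun x : \bar R => 0 <= x < +oo)%E).
- by rewrite lee01 ltry.
- move=> x y /andP[x0 xoo] /andP[y0 yoo]; rewrite mule_ge0//=.
  by rewrite lte_mul_pinfty// ge0_fin_numE.
- move=> i _; rewrite measure_ge0/= lebesgue_measure_itv/=.
  by case: ifP => // _; rewrite -EFinB ltry.
Qed.

End LebesgueRows.

(** * Barycentric coordinates and open simplices *)

Section Simplices.
Context {R : realType} {d : nat} (T : mesh R d).
Local Notation simplex := {set 'I_(nb_vertices T)}.
Local Notation vertex := (@vertex R d T).
Implicit Types K F : simplex.

Lemma open_simplex_bounded K (x : 'rV[R]_d) i : open_simplex K x ->
  `|x ord0 i| <= \sum_(k in K) `|vertex k ord0 i|.
Proof.
move=> [w [w0 w1 ->]]; rewrite summxE (le_trans (ler_norm_sum _ _ _))//.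
apply: ler_sum => k kK; rewrite mxE normrM ler_piMl// ger0_norm; last exact/ltW/w0.
rewrite -w1 (bigD1 k)//= lerDl; apply: sumr_ge0 => j /andP[jK _].
exact/ltW/w0.
Qed.

Lemma simplex_weights_unique K (w w' : 'I_(nb_vertices T) -> R) :
  affinely_independent K -> \sum_(k in K) w k = 1 -> \sum_(k in K) w' k = 1 ->
  \sum_(k in K) w k *: vertex k = \sum_(k in K) w' k *: vertex k ->
  forall k, k \in K -> w k = w' k.
Proof.
move=> aiK w1 w'1 ww' k kK; apply/eqP; rewrite -subr_eq0; apply/eqP.
apply: (aiK (fun k => w k - w' k)) => //.
  by rewrite sumrB w1 w'1 subrr.
under eq_bigr do rewrite scalerBl.
by rewrite sumrB ww' subrr.
Qed.

(* The barycentric coordinates of [x] are [(1, x) *m pinvmx B], where the rows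
   of [B] are the vertices with a leading [1]. *)
Lemma measurable_open_simplex K : #|K| = d.+1 -> affinely_independent K ->
  measurable (open_simplex K).
Proof.
move=> cK aiK.
pose lift1 (x : 'rV[R]_d) : 'rV[R]_(1 + d) := row_mx 1%:M x.
pose B : 'M[R]_(#|K|, 1 + d) := \matrix_k lift1 (vertex (enum_val k)).
have cB (c : 'rV[R]_#|K|) : c *m B =
    row_mx (\sum_k c ord0 k)%:M (\sum_k c ord0 k *: vertex (enum_val k)).
  rewrite mulmx_sum_row.
  under eq_bigr do rewrite rowK /lift1 scale_row_mx scale_scalar_mx mulr1.
  apply/rowP => j; rewrite summxE; case: (splitP j) => j' jE.
    have -> : j = lshift d j' by exact: val_inj.
    rewrite row_mxEl ord1 mxE eqxx mulr1n; apply: eq_bigr => k _.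
    by rewrite row_mxEl mxE eqxx mulr1n.
  have -> : j = rshift 1 j' by exact: val_inj.
  rewrite row_mxEr summxE; apply: eq_bigr => k _.
  by rewrite row_mxEr.
(* A left kernel vector of [B] is a family of weights with zero sum and zero weighted sum of the
   vertices, so affine independence makes it vanish. *)
have Bfree : row_free B.
  rewrite -kermx_eq0; apply/eqP/row_matrixP => l; rewrite row0.
  set c := row l _; have cB0 : c *m B = 0.
    by apply/sub_kermxP; exact: row_sub.
  move: cB0; rewrite cB -[X in _ = X](row_mx0 _ 1 1 d) => /eq_row_mx[c0 cv].
  pose w (j : 'I_(nb_vertices T)) : R :=
    if pselect (exists k, enum_val k = j) is left e then c ord0 (projT1 (cid e)) else 0.
  have wE k : w (enum_val k) = c ord0 k.
    rewrite /w; case: pselect => [e|[]]; last by exists k.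
    by congr (c _ _); apply: enum_val_inj; rewrite (projT2 (cid e)).
  have w0 : forall k, k \in K -> w k = 0.
    apply: aiK.
      rewrite big_enum_val; under eq_bigr do rewrite wE.
      by move/matrixP/(_ 0 0) : c0; rewrite !mxE.
    rewrite big_enum_val; under eq_bigr do rewrite wE.
    exact: cv.
  by apply/rowP => k; rewrite [RHS]mxE -wE w0 ?enum_valP.
(* With [d.+1] vertices [B] has as many rows as columns, so every [lift1 x] lies in its row
   space. *)
have Bfull : row_full B by rewrite /row_full (eqP Bfree) cK.
pose bary x := lift1 x *m pinvmx B.
rewrite (_ : open_simplex K = [set x | forall k, true -> 0 < bary x ord0 k]).
  apply: measurable_forall => k _; apply: measurable_polynomial_gt0.
  rewrite /bary (_ : (fun _ => _) = fun x => \sum_j lift1 x ord0 j * pinvmx B j k).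
    apply: polynomial_function_sum => j _; apply: poly_mul; last exact: poly_cst.
    rewrite /lift1; case: (splitP j) => j' jE.
      have -> : j = lshift d j' by exact: val_inj.
      by under eq_fun do rewrite row_mxEl; exact: poly_cst.
    have -> : j = rshift 1 j' by exact: val_inj.
    by under eq_fun do rewrite row_mxEr; exact: poly_coord.
  by apply/funext => x; rewrite mxE.
apply/seteqP; split => x /=.
  move=> [w [w0 w1 xE]] k _; rewrite /bary.
  have -> : lift1 x = (\row_k w (enum_val k)) *m B.
    rewrite cB /lift1 xE; congr (row_mx _%:M _).
      rewrite -w1 big_enum_val; apply: eq_bigr => l _; by rewrite mxE.
    by rewrite big_enum_val; apply: eq_bigr => l _; rewrite mxE.
  by rewrite mulmxKp// mxE w0 ?enum_valP.
move=> bx; pose w j := if pselect (exists k : 'I_#|K|, enum_val k = j) is left e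
  then bary x ord0 (projT1 (cid e)) else 0.
have wE k : w (enum_val k) = bary x ord0 k.
  rewrite /w; case: pselect => [e|[]]; last by exists k.
  by congr (bary _ _ _); apply: enum_val_inj; rewrite (projT2 (cid e)).
have : bary x *m B = lift1 x by rewrite /bary mulmxKpV// submx_full.
rewrite cB => /eq_row_mx[c1 cv]; exists w; split.
- move=> j jK; rewrite -(enum_rankK_in jK jK) wE; exact: bx.
- rewrite big_enum_val; under eq_bigr do rewrite wE.
  by move/matrixP/(_ 0 0) : c1; rewrite !mxE.
- rewrite big_enum_val; under eq_bigr do rewrite wE.
  by rewrite cv.
Qed.

End Simplices.

(** By conformity a common point has weights on the vertices of [K :&: K']. Extended by zero, these
    coincide with its positive weights on [K], so [K] is contained in [K'], and the cardinals
    agree. *)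
Lemma open_simplex_disjoint (R : realType) (d : nat) (T : mesh R d) Omega K K' x :
  triangulation T Omega -> K \in cells T -> K' \in cells T ->
  open_simplex K x -> open_simplex K' x -> K = K'.
Proof.
move=> [cell _ _ capE] cK cK' [w [w0 w1 xE]] [w' [w'0 w'1 xE']].
have [[nK aiK] [nK' aiK']] := (cell K cK, cell K' cK').
have [x0 [x00 x01 xE0]] : closed_simplex (K :&: K') x.
  rewrite -capE//; split.
    by exists w; split=> // i iK; exact/ltW/w0.
  by exists w'; split=> // i iK; exact/ltW/w'0.
have sub (F : {set 'I_(nb_vertices T)}) (f : 'I_(nb_vertices T) -> R) :
    \sum_(k in K) (if k \in F then f k else 0)
    = \sum_(k in K :&: F) f k.
  rewrite -big_mkcondr/=; apply: eq_bigl => k; by rewrite inE.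
have subv (F : {set 'I_(nb_vertices T)}) (f : 'I_(nb_vertices T) -> R) :
    \sum_(k in K) (if k \in F then f k else 0) *: vertex k
    = \sum_(k in K :&: F) f k *: vertex k.
  rewrite [LHS](eq_bigr (fun k => if k \in F then f k *: vertex k else 0)).
    by rewrite -big_mkcondr/=; apply: eq_bigl => k; rewrite inE.
  by move=> k _; case: ifP => // _; rewrite scale0r.
have wE := @simplex_weights_unique _ _ _ _ w
  (fun k => if k \in K' then x0 k else 0) aiK w1.
rewrite sub subv -xE -xE0 in wE.
have KK' : K \subset K'.
  apply/fintype.subsetP => k kK; have := w0 k kK.
  by rewrite wE//; case: ifP => //; rewrite ltxx.
by apply/eqP; rewrite eqEcard KK' nK nK' leqnn.
Qed.

(** * The reference simplex of the face parametrization *)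

Section ReferenceSimplex.
Context {R : realType} {d : nat}.

Lemma measurable_reference_simplex : measurable (@reference_simplex R d).
Proof.
rewrite (_ : reference_simplex =
    [set s | forall k, true -> [set s : 'rV[R]_d.-1 | 0 < s ord0 k] s] `&`
    [set s : 'rV[R]_d.-1 | 0 < 1 + \sum_(k < d.-1) -1 * s ord0 k]).
  apply: measurableI.
    apply: measurable_forall => k _; apply: measurable_polynomial_gt0.
    exact: poly_coord.
  apply: measurable_polynomial_gt0; apply: poly_add; first exact: poly_cst.
  apply: polynomial_function_sum => k _.
  by apply: poly_mul; [exact: poly_cst|exact: poly_coord].
by apply/seteqP; split => s /= [s0];
  (under eq_bigr do rewrite mulN1r); rewrite sumrN subr_gt0 => s1;
  split => // k; exact: s0.
Qed.

Lemma reference_simplex_bounded s k :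
  @reference_simplex R d s -> `|s ord0 k| <= 1.
Proof.
move=> [s0 s1]; rewrite ger0_norm ?(ltW (s0 k))// (le_trans _ (ltW s1))//.
rewrite (bigD1 k)//= lerDl; apply: sumr_ge0 => j _; exact/ltW/s0.
Qed.

End ReferenceSimplex.

(** * The affine parametrization of a face *)

Section Faces.
Context {R : realType}.

(** Elements of [Vh] are polynomial on relatively open faces only, so face integrals must evaluate
    them there. *)
Lemma face_map_open_simplex d (T : mesh R d) (F : {set 'I_(nb_vertices T)}) s :
  (0 < d)%N -> #|F| = d -> reference_simplex s -> open_simplex F (face_map F s).
Proof.
case: d T F s => // d T F s _ cF [/= s0 s1].
have sF : size (enum F) = d.+1 by rewrite -cardE.
have [i0 i0F] : exists i0, i0 \in F by apply/card_gt0P; rewrite cF.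
pose v k := nth i0 (enum F) k.
have vE k : (k < d.+1)%N -> face_vertex F k = vertex (v k).
  by move=> kd; rewrite /face_vertex (nth_map i0) ?sF.
have vK k : (k < d.+1)%N -> index (v k) (enum F) = k.
  by move=> kd; rewrite index_uniq ?enum_uniq ?sF.
(* Vertex number [k.+1] of the enumeration receives [s ord0 k] and vertex 0 the remainder; the
   conditional sum selects the coordinate without a bound on the index. *)
pose w i := if index i (enum F) == 0%N then 1 - \sum_(k < d) s ord0 k
  else \sum_(k < d | k.+1 == index i (enum F)) s ord0 k.
have w0 : w (v 0%N) = 1 - \sum_(k < d) s ord0 k by rewrite /w vK.
have wS (k : 'I_d) : w (v k.+1) = s ord0 k.
  rewrite /w vK ?ltnS//= (bigD1 k)//= big1 ?addr0// => j /andP[].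
  by rewrite eqSS => /eqP/val_inj ->; rewrite eqxx.
have sumF (V : zmodType) (g : 'I_(nb_vertices T) -> V) :
    \sum_(i in F) g i = g (v 0%N) + \sum_(k < d) g (v k.+1).
  by rewrite -big_enum (big_nth i0) sF big_mkord big_ord_recl.
exists w; split.
- move=> i iF; have iE : v (index i (enum F)) = i by rewrite /v nth_index ?mem_enum.
  move: (iF); rewrite -mem_enum -index_mem sF -{2}iE.
  case: (index i (enum F)) => [|k] kd; first by rewrite w0 subr_gt0.
  by rewrite (wS (Ordinal (kd : (k < d)%N))).
- by rewrite sumF w0 (eq_bigr _ (fun k _ => wS k)) subrK.
- rewrite sumF w0 /face_map /face_edge vE//.
  rewrite scalerBl scale1r -addrA; congr (_ + _).
  rewrite scaler_suml -sumrN -big_split/=; apply: eq_bigr => k _.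
  by rewrite vE ?ltnS// wS scalerBr addrC.
Qed.

Lemma bounded_measurable_face_map d (T : mesh R d) (F : {set 'I_(nb_vertices T)}) i :
  bounded_measurable reference_simplex (fun s => face_map F s ord0 i).
Proof.
rewrite (_ : (fun _ => _) = fun s : 'rV[R]_d.-1 => face_vertex F 0 ord0 i +
    \sum_(k < d.-1) s ord0 k * face_edge F k ord0 i); last first.
  apply/funext => s; rewrite /face_map mxE summxE; congr (_ + _).
  by apply: eq_bigr => k _; rewrite mxE.
apply: bounded_measurableD; first exact: bounded_measurable_cst.
apply: bounded_measurable_sum => k _; apply: bounded_measurableM.
  split; first exact: measurable_funS (@measurable_coord _ _ _ _).
  by exists 1 => s; exact: reference_simplex_bounded.
exact: bounded_measurable_cst.
Qed.

End Faces.

(** * The Euclidean product and entrywise bounds from ellipticity *)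

Section DotProduct.
Context {R : realType} {d : nat}.
Implicit Types x y : 'rV[R]_d.

Lemma dotC x y : dot x y = dot y x.
Proof. by apply: eq_bigr => i _; rewrite mulrC. Qed.

Lemma dotDl k x y z : dot (k *: x + y) z = k * dot x z + dot y z.
Proof.
rewrite /dot mulr_sumr -big_split; apply: eq_bigr => i _.
by rewrite !mxE mulrDl mulrA.
Qed.

Lemma dot_ge0 x : 0 <= dot x x.
Proof. by apply: sumr_ge0 => i _; rewrite -expr2 sqr_ge0. Qed.

Lemma dot_eq0 x : dot x x = 0 -> x = 0.
Proof.
move=> /eqP; rewrite psumr_eq0 => [/allP x0|i _]; last by rewrite -expr2 sqr_ge0.
apply/rowP => i; have := x0 i (mem_index_enum _).
by rewrite -expr2 sqrf_eq0 mxE => /eqP.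
Qed.

Lemma dot_delta_mx (M : 'M[R]_d) i j :
  dot (delta_mx ord0 i *m M) (delta_mx ord0 j) = M i j.
Proof.
rewrite -rowE /dot (bigD1 j)//= !mxE !eqxx mulr1 big1 ?addr0// => k /negPf kj.
by rewrite !mxE kj andbF mulr0.
Qed.

Lemma dot_trmx (M : 'M[R]_d) x y : dot (x *m M^T) y = dot x (y *m M).
Proof.
rewrite /dot; under eq_bigr do rewrite mxE mulr_suml.
rewrite exchange_big; apply: eq_bigr => i _; rewrite mxE mulr_sumr.
by apply: eq_bigr => j _; rewrite !mxE -mulrA (mulrC (M j i)).
Qed.

(* Polarization: [2 M i j] is the value of the form at [e_i + e_j] minus the
   two diagonal values, all of which lie between [0] and [2 C]. *)
Lemma elliptic_entry_bounded (M : 'M[R]_d) (c C : R) : 0 < c -> M^T = M ->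
  (forall x, c * dot x x <= dot (x *m M^T) x <= C * dot x x) ->
  forall i j, `|M i j| <= C.
Proof.
move=> c0 sM ellM i j; rewrite sM in ellM.
have dd (k l : 'I_d) : dot (delta_mx ord0 k) (delta_mx ord0 l) = (k == l)%:R :> R.
  by rewrite -[delta_mx ord0 k]mulmx1 dot_delta_mx mxE.
have diag k : 0 <= M k k <= C.
  have := ellM (delta_mx ord0 k); rewrite dot_delta_mx dd eqxx !mulr1.
  by move=> /andP[/(le_trans (ltW c0)) -> ->].
have [<-|/negPf ij] := eqVneq i j.
  by have /andP[m0 mC] := diag i; rewrite ger0_norm.
have sMij : M j i = M i j by rewrite -[in LHS]sM mxE.
have := ellM (1 *: delta_mx ord0 i + delta_mx ord0 j).
rewrite mulmxDl -scalemxAl !dotDl !(dotC _ (1 *: _ + _)) !dotDl.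
rewrite !(dotC _ (_ *m M)) !dot_delta_mx !dd !eqxx ij eq_sym ij sMij.
have /andP[? ?] := diag i; have /andP[? ?] := diag j.
by rewrite /= => /andP[? ?]; rewrite ler_norml; apply/andP; split; lra.
Qed.

End DotProduct.

(** * Linear structure of the polynomial spaces *)

Section PolynomialSpaces.
Context {R : realType} {d : nat}.

Lemma poly_le_lin k (a : R) (p q : 'rV[R]_d -> R) :
  poly_le k p -> poly_le k q -> poly_le k (fun x => a * p x + q x).
Proof.
move=> [b pE] [c qE]; exists (fun alpha => a * b alpha + c alpha) => x.
rewrite pE qE mulr_sumr -big_split; apply: eq_bigr => alpha _.
by rewrite mulrDl mulrA.
Qed.

Lemma poly_homog_lin k (a : R) (p q : 'rV[R]_d -> R) :
  poly_homog k p -> poly_homog k q -> poly_homog k (fun x => a * p x + q x).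
Proof.
move=> [b pE] [c qE]; exists (fun alpha => a * b alpha + c alpha) => x.
rewrite pE qE mulr_sumr -big_split; apply: eq_bigr => alpha _.
by rewrite mulrDl mulrA.
Qed.

Lemma poly_le0 k : @poly_le R d k (fun=> 0).
Proof. by exists (fun=> 0) => x; rewrite big1// => alpha _; rewrite mul0r. Qed.

Lemma vec_poly_le_lin k (a : R) (p q : 'rV[R]_d -> 'rV[R]_d) :
  vec_poly_le k p -> vec_poly_le k q -> vec_poly_le k (fun x => a *: p x + q x).
Proof.
move=> pp pq i; have := poly_le_lin a (pp i) (pq i).
rewrite (_ : (fun x => (a *: p x + q x) ord0 i) =
    fun x => a * p x ord0 i + q x ord0 i)//.
by apply/funext => x; rewrite !mxE.
Qed.

Lemma G_space_lin r t (a : R) (p q : 'rV[R]_d -> 'rV[R]_d) :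
  G_space r t p -> G_space r t q -> G_space r t (fun x => a *: p x + q x).
Proof.
rewrite /G_space; case: ifP => _; last exact: vec_poly_le_lin.
move=> [p1 [s1 [hp1 hs1 pE]]] [p2 [s2 [hp2 hs2 qE]]].
exists (fun x => a *: p1 x + p2 x), (fun x => a * s1 x + s2 x); split.
- exact: vec_poly_le_lin.
- exact: poly_homog_lin.
- move=> x; rewrite pE qE scalerDr scalerA addrACA [in RHS]scalerDl.
  by [].
Qed.

End PolynomialSpaces.

(** * Linearity of real integrals and their behaviour up to null sets *)

Section IntegralOfSquare.
Context {disp : measure_display} {X : measurableType disp} {R : realType}.
Context (mu : {measure set X -> \bar R}) (D : set X).
Hypothesis mD : measurable D.

Lemma Rintegral_sum (I : Type) (s : seq I) (P : pred I) (F : I -> X -> R) :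
  (forall i, P i -> mu.-integrable D (EFin \o F i)) ->
  \int[mu]_(x in D) \sum_(i <- s | P i) F i x =
  \sum_(i <- s | P i) \int[mu]_(x in D) F i x.
Proof.
move=> intF; suff [] : mu.-integrable D (EFin \o (fun x => \sum_(i <- s | P i) F i x)) /\
    \int[mu]_(x in D) \sum_(i <- s | P i) F i x =
    \sum_(i <- s | P i) \int[mu]_(x in D) F i x by [].
elim: s => [|i s [IHi IHs]].
  under eq_fun do rewrite big_nil; rewrite big_nil; split.
    exact: integrable0.
  by rewrite Rintegral_cst// mul0r.
under eq_fun do rewrite big_cons; rewrite big_cons.
case: (boolP (P i)) => // Pi; split; last by rewrite RintegralD ?IHs//; exact: intF.
rewrite (_ : EFin \o _ =
  (EFin \o F i) \+ (EFin \o (fun x => \sum_(i <- s | P i) F i x)))//.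
by apply: integrableD => //; exact: intF.
Qed.

Hypothesis muD : (mu D < +oo)%E.

Lemma Rintegral_lin (f g : X -> R) k : bounded_measurable D f ->
  bounded_measurable D g ->
  \int[mu]_(x in D) (k * f x + g x) =
  k * \int[mu]_(x in D) f x + \int[mu]_(x in D) g x.
Proof.
move=> bf bg; have bkf := bounded_measurableM (bounded_measurable_cst D k) bf.
rewrite RintegralD ?RintegralZl//; exact: bounded_measurable_integrable.
Qed.

Lemma Rintegral_eq0_ae (f : X -> R) : bounded_measurable D f ->
  (forall x, D x -> 0 <= f x) -> \int[mu]_(x in D) f x = 0 ->
  {ae mu, forall x, D x -> f x = 0}.
Proof.
move=> bf f0 intf0; have intf := bounded_measurable_integrable mD muD bf.
have mf : measurable_fun D (EFin \o f) by apply/measurable_EFinP; case: bf.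
have : (\int[mu]_(x in D) `|(EFin \o f) x| = 0)%E.
  rewrite (eq_integral (EFin \o f)) => [|x /set_mem Dx]; last first.
    by rewrite gee0_abs// lee_fin f0.
  rewrite -[LHS]fineK ?(integrable_fin_num mD)//.
  by congr (_ %:E); rewrite -[RHS]intf0.
move=> /(ae_eq_integral_abs mu mD mf); apply: filterS => x /[swap] Dx /(_ Dx).
by move=> [].
Qed.

Lemma Rintegral_ae_eq (f g : X -> R) : bounded_measurable D f ->
  bounded_measurable D g -> {ae mu, forall x, D x -> f x = g x} ->
  \int[mu]_(x in D) f x = \int[mu]_(x in D) g x.
Proof.
move=> [mf _] [mg _] fg; congr fine; apply: ae_eq_integral => //.
- exact/measurable_EFinP.
- exact/measurable_EFinP.
- by apply: filterS fg => x fgx Dx; rewrite /= fgx.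
Qed.

End IntegralOfSquare.

(** * Integrands on a single cell *)

Section Cells.
Context {R : realType} {d : nat} (T : mesh R d) (Omega : set 'rV[R]_d).
Hypothesis hT : triangulation T Omega.
Context (K : {set 'I_(nb_vertices T)}).
Hypothesis cK : K \in cells T.

Lemma measurable_cell : measurable (open_simplex K).
Proof.
have [cell _ _ _] := hT; have [] := cell K cK.
exact: measurable_open_simplex.
Qed.

Lemma open_simplex_sub : open_simplex K `<=` Omega.
Proof. by have [_ + _ _] := hT; exact. Qed.

Lemma lebesgue_cell : (lebesgue_rV d (open_simplex K) < +oo)%E.
Proof.
apply: (@lebesgue_rV_bounded _ _ _
  (\sum_i \sum_(k in K) `|vertex k ord0 i|) measurable_cell) => x Kx i.
apply: le_trans (open_simplex_bounded i Kx) _.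
by rewrite [leRHS](bigD1 i)//= lerDl; do 2 (apply: sumr_ge0 => ? _).
Qed.

Lemma polynomial_function_cell (p : 'rV[R]_d -> R) :
  polynomial_function p -> bounded_measurable (open_simplex K) p.
Proof.
apply: (@bounded_measurable_polynomial _ _ _ _ _ id) => i.
split; first exact: measurable_funS (@measurable_coord _ _ _ _).
by exists (\sum_(k in K) `|vertex k ord0 i|) => x; exact: open_simplex_bounded.
Qed.

Lemma cell_integral_lin (f g : 'rV[R]_d -> R) k :
  bounded_measurable (open_simplex K) f ->
  bounded_measurable (open_simplex K) g ->
  cell_integral K (fun x => k * f x + g x) =
  k * cell_integral K f + cell_integral K g.
Proof. exact: (Rintegral_lin measurable_cell lebesgue_cell). Qed.

Lemma eq_cell_integral (f g : 'rV[R]_d -> R) :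
  (forall x, open_simplex K x -> f x = g x) ->
  cell_integral K f = cell_integral K g.
Proof. by move=> fg; apply: eq_Rintegral => x /set_mem; exact: fg. Qed.

Lemma bounded_measurable_dot (p q : 'rV[R]_d -> 'rV[R]_d) :
  (forall i, bounded_measurable (open_simplex K) (fun x => p x ord0 i)) ->
  (forall i, bounded_measurable (open_simplex K) (fun x => q x ord0 i)) ->
  bounded_measurable (open_simplex K) (fun x => dot (p x) (q x)).
Proof.
by move=> bp bq; apply: bounded_measurable_sum => i _; exact: bounded_measurableM.
Qed.

(** Membership in the Lebesgue space supplies measurability; the pointwise bound comes from symmetry
    and ellipticity. *)
Lemma coefficient_cell (A : 'rV[R]_d -> 'M[R]_d) c C i j :
  0 < c -> elliptic_coefficient Omega A c C ->
  bounded_measurable (open_simplex K) (fun x => A x i j).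
Proof.
move=> c0 [LA sA eA]; split; last first.
  exists C => x /open_simplex_sub Ox.
  exact: (elliptic_entry_bounded c0 (sA x Ox) (fun xi => eA x xi Ox)).
have mA : measurable_fun setT ((fun x => A x i j) \_ Omega).
  by have := LA i j; rewrite inE => /andP[/[!inE]].
apply: (@eq_measurable_fun _ _ _ _ _ ((fun x => A x i j) \_ Omega)).
  by move=> x /set_mem/open_simplex_sub Ox; rewrite patchE mem_set.
exact: measurable_funS mA.
Qed.

(** This makes the pairing of [u] with an interior part integrable on each cell, as splitting the
    integral over [Omega] requires. *)
Lemma L2_cell_integrable (f p : 'rV[R]_d -> R) :
  L2 Omega f -> bounded_measurable (open_simplex K) p ->
  (lebesgue_rV d).-integrable (open_simplex K) (EFin \o (fun x => f x * p x)).
Proof.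
move=> L2f bp; apply: (square_integrableM measurable_cell lebesgue_cell) => //.
  apply: (@eq_measurable_fun _ _ _ _ _ (f \_ Omega)).
    by move=> x /set_mem/open_simplex_sub Ox; rewrite patchE mem_set.
  have mf : measurable_fun setT (f \_ Omega).
    by have := L2f; rewrite /L2 inE => /andP[/[!inE]].
  exact: measurable_funS mf.
have := Lfun2_integrable_sqr L2f.
move/(integrableS measurableT measurable_cell (@subsetT _ _)).
apply: eq_integrable; first exact: measurable_cell.
by move=> x /set_mem/open_simplex_sub Ox; rewrite /= patchE mem_set.
Qed.

End Cells.

(** * Splitting an integral over the domain into cell integrals *)

Section CellSum.
Context {R : realType} {d : nat} (T : mesh R d) (Omega : set 'rV[R]_d).
Hypothesis hT : triangulation T Omega.

(* As [f] vanishes off the open cells, the skeleton of the mesh need not be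
   shown to be negligible. *)
Lemma Rintegral_cells (f : 'rV[R]_d -> R) :
  (forall K, K \in cells T ->
    (lebesgue_rV d).-integrable (open_simplex K) (EFin \o f)) ->
  (forall x, (forall K, K \in cells T -> ~ open_simplex K x) -> f x = 0) ->
  \int[lebesgue_rV d]_(x in Omega) f x = \sum_(K in cells T) cell_integral K f.
Proof.
move=> intf f0; rewrite Rintegral_mkcond.
(* A point of an open cell lies in no other one, so a single term survives there; elsewhere both
   sides vanish. *)
have -> : f \_ Omega = fun x => \sum_(K in cells T) (f \_ (open_simplex K)) x.
  apply/funext => x; have [[K [cK Kx]]|noK] :=
      pselect (exists K, K \in cells T /\ open_simplex K x).
    rewrite patchE mem_set; last exact: (open_simplex_sub hT cK).
    rewrite (bigD1 K)//= patchE mem_set// big1 ?addr0// => K' /andP[cK' K'K].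
    rewrite patchE memNset// => K'x.
    by move/eqP : K'K; apply; exact: (open_simplex_disjoint hT cK' cK K'x Kx).
  have Kx K : K \in cells T -> ~ open_simplex K x.
    by move=> cK Kx; apply: noK; exists K.
  rewrite big1 => [|K cK]; last by rewrite patchE memNset//; exact: Kx.
  by rewrite patchE; case: ifP => // _; exact: f0.
rewrite Rintegral_sum// => [|K cK].
  by apply: eq_bigr => K _; rewrite -Rintegral_mkcond.
have /(integrable_mkcond _ (measurable_cell hT cK)) := intf K cK.
by rewrite restrict_EFin.
Qed.

End CellSum.

(** * The weak Galerkin space and its two bilinear forms *)

Section WeakGalerkinSpace.
Context {R : realType} {d : nat} (T : mesh R d) (Omega : set 'rV[R]_d).
Hypothesis d_gt0 : (0 < d)%N.
Hypothesis hT : triangulation T Omega.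
Context (r t : nat).
Local Notation simplex := {set 'I_(nb_vertices T)}.
Local Notation Vh := (Vh T Omega r t).
Implicit Types (v w z : wg_function R d) (K F : simplex).

Lemma Vh0 : Vh 0.
Proof.
by split=> // K cK; exists (fun=> 0) => //; exact: poly_le0.
Qed.

Lemma interior_part_lin k v w x :
  interior_part (k *: v + w) x = k * interior_part v x + interior_part w x.
Proof. by []. Qed.

Lemma boundary_part_lin k v w x :
  boundary_part (k *: v + w) x = k * boundary_part v x + boundary_part w x.
Proof. by []. Qed.

Lemma Vh_lin k v w : Vh v -> Vh w -> Vh (k *: v + w).
Proof.
move=> [v1 v2 v3 v4 v5] [w1 w2 w3 w4 w5]; split.
- move=> K cK; have [p pp vp] := v1 K cK; have [q pq wq] := w1 K cK.
  exists (fun x => k * p x + q x); first exact: poly_le_lin.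
  by move=> x Kx; rewrite -vp// -wq.
- by move=> x nx; rewrite interior_part_lin v2// w2// mulr0 addr0.
- move=> F cF; have [p pp vp] := v3 F cF; have [q pq wq] := w3 F cF.
  exists (fun x => k * p x + q x); first exact: poly_le_lin.
  by move=> x Fx; rewrite -vp// -wq.
- move=> F cF bF x Fx.
  by rewrite boundary_part_lin (v4 F)// (w4 F)// mulr0 addr0.
- by move=> x nx; rewrite boundary_part_lin v5// w5// mulr0 addr0.
Qed.

Lemma interior_part_cell K v : K \in cells T -> Vh v ->
  bounded_measurable (open_simplex K) (interior_part v).
Proof.
move=> cK [/(_ K cK)[p pp vp] _ _ _ _].
apply: (@eq_bounded_measurable _ _ _ _ p) => [x Kx|]; first by rewrite vp.
by apply: polynomial_function_cell; exact: poly_le_polynomial_function pp.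
Qed.

Lemma mem_faces K F : K \in cells T -> F \in faces_of K ->
  F \in faces T /\ #|F| = d.
Proof.
move=> cK; rewrite !inE => /andP[/eqP cF FK]; split => //.
by rewrite cF eqxx/=; apply/existsP; exists K; rewrite cK.
Qed.

Lemma lebesgue_reference_simplex :
  (lebesgue_rV d.-1 (@reference_simplex R d) < +oo)%E.
Proof.
apply: (@lebesgue_rV_bounded _ _ _ 1); first exact: measurable_reference_simplex.
by move=> s ss i; exact: reference_simplex_bounded.
Qed.

Lemma boundary_part_face K F v (p : 'rV[R]_d -> R) :
  K \in cells T -> F \in faces_of K -> Vh v -> polynomial_function p ->
  bounded_measurable reference_simplex
    (fun s => boundary_part v (face_map F s) * p (face_map F s)).
Proof.
move=> cK FK [_ _ v3 _ _] pp; have [fF cF] := mem_faces cK FK.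
have [q qq vq] := v3 F fF; apply: bounded_measurableM; last first.
  exact: (bounded_measurable_polynomial (bounded_measurable_face_map F) pp).
apply: (@eq_bounded_measurable _ _ _ _ (q \o face_map F)).
  by move=> s ss; rewrite vq//; exact: face_map_open_simplex.
apply: (bounded_measurable_polynomial (bounded_measurable_face_map F)).
exact: poly_le_polynomial_function qq.
Qed.

Lemma face_integral_lin K F k v w (p : 'rV[R]_d -> R) :
  K \in cells T -> F \in faces_of K -> Vh v -> Vh w -> polynomial_function p ->
  face_integral F (fun x => boundary_part (k *: v + w) x * p x) =
  k * face_integral F (fun x => boundary_part v x * p x) +
  face_integral F (fun x => boundary_part w x * p x).
Proof.
move=> cK FK Vv Vw pp; rewrite /face_integral mulrCA -mulrDr; congr (_ * _).
rewrite -(Rintegral_lin measurable_reference_simplex lebesgue_reference_simplex).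
- apply: eq_Rintegral => s _.
  by rewrite boundary_part_lin mulrDl mulrA.
- exact: (boundary_part_face cK FK Vv pp).
- exact: (boundary_part_face cK FK Vw pp).
Qed.

Lemma bh_lin k v w z : Vh v -> Vh w -> Vh z ->
  bh T (k *: v + w) z = k * bh T v z + bh T w z.
Proof.
move=> Vv Vw Vz; rewrite /bh mulr_sumr -big_split; apply: eq_bigr => K cK.
rewrite [RHS]/= -(cell_integral_lin hT cK).
- by apply: eq_cell_integral => x _; rewrite interior_part_lin mulrDl mulrA.
- by apply: bounded_measurableM; exact: interior_part_cell.
- by apply: bounded_measurableM; exact: interior_part_cell.
Qed.

Lemma bhC v w : bh T v w = bh T w v.
Proof.
by apply: eq_bigr => K _; apply: eq_cell_integral => x _; rewrite mulrC.
Qed.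

(** On each cell the interior part of [v] is a polynomial of degree at most [r], against which [u]
    and its projection have the same integral. *)
Lemma bh_L2_Qh (u : H10 Omega) Qu v : is_Qh T r t u Qu -> Vh v ->
  bh_L2 Omega u v = bh T Qu v.
Proof.
move=> [_ Qu0 _] Vv; have [L2u _ _] := H10_H1 u.
rewrite /bh_L2 (Rintegral_cells hT).
- apply: eq_bigr => K cK; have [/(_ K cK)[p pp vp] _ _ _ _] := Vv.
  rewrite (@eq_cell_integral _ _ _ _ _ (fun x => u x * p x)); last first.
    by move=> x Kx; rewrite vp.
  by rewrite -Qu0//; apply: eq_cell_integral => x Kx; rewrite vp.
- by move=> K cK; apply: (L2_cell_integrable hT cK) => //; exact: interior_part_cell.
- by move=> x nx; case: Vv => _ /(_ x nx) + _ _ _ => ->; rewrite mulr0.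
Qed.

Context (gradw : wg_function R d -> simplex -> 'rV[R]_d -> 'rV[R]_d).
Hypothesis hgradw : discrete_weak_gradient Omega r t gradw.

Lemma gradw_cell K v i : K \in cells T -> Vh v ->
  bounded_measurable (open_simplex K) (fun x => gradw v K x ord0 i).
Proof.
move=> cK Vv; have [Gv _] := hgradw Vv cK.
apply: polynomial_function_cell.
exact: (G_space_polynomial_function i Gv).
Qed.

(* The defect of linearity lies in [G_space], and is orthogonal to it. *)
Lemma gradw_lin K k v w : K \in cells T -> Vh v -> Vh w ->
  {ae lebesgue_rV d, forall x, open_simplex K x ->
    gradw (k *: v + w) K x = k *: gradw v K x + gradw w K x}.
Proof.
move=> cK Vv Vw; have Vvw := Vh_lin k Vv Vw.
have [[Gv Ev] [Gw Ew]] := (hgradw Vv cK, hgradw Vw cK).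
have [Gvw Evw] := hgradw Vvw cK.
(* The defect of linearity, arranged so that [G_space_lin] and [dotDl] apply to it. *)
pose g x := (-1) *: (k *: gradw v K x + gradw w K x) + gradw (k *: v + w) K x.
have Gg : G_space r t g by apply: G_space_lin => //; exact: G_space_lin.
have bG q : G_space r t q -> forall i,
    bounded_measurable (open_simplex K) (fun x => q x ord0 i).
  move=> Gq i; apply: polynomial_function_cell.
  exact: (G_space_polynomial_function i Gq).
have bD p q Gp Gq := bounded_measurable_dot (bG p Gp) (bG q Gq).
(* Testing the three weak gradients against [g] itself leaves interior and boundary terms, which
   cancel by linearity. *)
have gg0 : cell_integral K (fun x => dot (g x) (g x)) = 0.
  transitivity (cell_integral K (fun x => -1 *
      (k * dot (gradw v K x) (g x) + dot (gradw w K x) (g x)) +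
      dot (gradw (k *: v + w) K x) (g x))).
    by apply: eq_cell_integral => x _; rewrite {1}/g !dotDl.
  have bvw : bounded_measurable (open_simplex K)
      (fun x => k * dot (gradw v K x) (g x) + dot (gradw w K x) (g x)).
    apply: bounded_measurableD; last exact: bD.
    by apply: bounded_measurableM; [exact: bounded_measurable_cst|exact: bD].
  rewrite (cell_integral_lin hT cK)//; last exact: bD.
  rewrite (cell_integral_lin hT cK); [|exact: bD|exact: bD].
  rewrite Ev// Ew// Evw//.
  have Edivg := polynomial_function_cell K (polynomial_function_divergence Gg).
  have -> : cell_integral K (fun x => interior_part (k *: v + w) x * divergence g x) =
      k * cell_integral K (fun x => interior_part v x * divergence g x) +
      cell_integral K (fun x => interior_part w x * divergence g x).
    rewrite -(cell_integral_lin hT cK).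
    - by apply: eq_cell_integral => x _; rewrite interior_part_lin mulrDl mulrA.
    - by apply: bounded_measurableM => //; exact: interior_part_cell.
    - by apply: bounded_measurableM => //; exact: interior_part_cell.
  have -> : \sum_(F in faces_of K) face_integral F
        (fun x => boundary_part (k *: v + w) x * dot (g x) (normal K F)) =
      k * (\sum_(F in faces_of K) face_integral F
        (fun x => boundary_part v x * dot (g x) (normal K F))) +
      \sum_(F in faces_of K) face_integral F
        (fun x => boundary_part w x * dot (g x) (normal K F)).
    rewrite mulr_sumr -big_split; apply: eq_bigr => F FK.
    apply: (face_integral_lin k cK FK Vv Vw).
    apply: polynomial_function_sum => i _; apply: poly_mul; last exact: poly_cst.
    exact: G_space_polynomial_function Gg.
  ring.
have := Rintegral_eq0_ae (measurable_cell hT cK) (lebesgue_cell hT cK) (bD _ _ Gg Gg)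
  (fun x _ => dot_ge0 (g x)) gg0.
apply: filterS => x gx0 Kx; have /dot_eq0 := gx0 Kx.
by rewrite /g scaleN1r addrC => /eqP; rewrite subr_eq0 => /eqP.
Qed.

Context (A : 'rV[R]_d -> 'M[R]_d) (c C : R).
Hypotheses (c0 : 0 < c) (hA : elliptic_coefficient Omega A c C).

Lemma ah_integrand_cell K v w : K \in cells T -> Vh v -> Vh w ->
  bounded_measurable (open_simplex K)
    (fun x => dot (gradw v K x *m (A x)^T) (gradw w K x)).
Proof.
move=> cK Vv Vw; apply: bounded_measurable_dot => i; last exact: gradw_cell.
under eq_fun do rewrite mxE.
apply: bounded_measurable_sum => j _; apply: bounded_measurableM.
  exact: gradw_cell.
under eq_fun do rewrite mxE.
exact: (coefficient_cell hT cK i j c0 hA).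
Qed.

(** The integrands agree only off the null set of [gradw_lin], which the cell integrals do not
    see. *)
Lemma ah_lin k v w z : Vh v -> Vh w -> Vh z ->
  ah gradw A (k *: v + w) z = k * ah gradw A v z + ah gradw A w z.
Proof.
move=> Vv Vw Vz; rewrite /ah mulr_sumr -big_split; apply: eq_bigr => K cK /=.
have bv := ah_integrand_cell cK Vv Vz; have bw := ah_integrand_cell cK Vw Vz.
rewrite -(cell_integral_lin hT cK)//; apply: Rintegral_ae_eq.
- exact: measurable_cell hT _ cK.
- by apply: ah_integrand_cell => //; exact: Vh_lin.
- apply: bounded_measurableD => //; apply: bounded_measurableM => //.
  exact: bounded_measurable_cst.
- apply: filterS (gradw_lin k cK Vv Vw) => x vwx Kx.
  by rewrite vwx// mulmxDl -scalemxAl dotDl.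
Qed.

Lemma ahC v w : ah gradw A v w = ah gradw A w v.
Proof.
have [_ sA _] := hA.
apply: eq_bigr => K cK; apply: eq_cell_integral => x /(open_simplex_sub hT cK) Ox.
by rewrite dot_trmx dotC sA.
Qed.

End WeakGalerkinSpace.

(** * Order of the discrete eigenvalues and of their inverses *)

Section DiscreteEigenvalues.
Context {R : realType} (n : nat) (mu : 'I_n.+1 -> R) (lam : 'I_n.+1 -> \bar R).
Hypothesis lamE : forall j, lam j = ((mu j)%:E^-1)%E.
Hypothesis lam_gt0 : forall j, (0 < lam j)%E.
Hypothesis lam_le : forall j k : 'I_n.+1, (j <= k)%N -> (lam j <= lam k)%E.

Lemma mubar_ge0 j : 0 <= mu j.
Proof. by have := ltW (lam_gt0 j); rewrite lamE inve_ge0 lee_fin. Qed.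

(** Inversion reverses the order, with 0 sent to [+oo]: if [mu ord0] were zero and [mu j] were not,
    the infinite [lam ord0] would be bounded by a finite [lam j]. *)
Lemma mubar_le_first j : mu j <= mu ord0.
Proof.
have [->|muj] := eqVneq (mu j) 0; first exact: mubar_ge0.
have mj0 : 0 < mu j by rewrite lt0r muj mubar_ge0.
have := lam_le (leq0n j : (@ord0 n <= j)%N); rewrite !lamE !inver (negPf muj).
have [//|mu0] := eqVneq (mu ord0) 0.
by rewrite lee_fin lef_pV2 ?posrE// lt0r mu0 mubar_ge0.
Qed.

End DiscreteEigenvalues.

(** * The abstract estimates applied to the weak Galerkin forms *)

Theorem theorem2p2 (R : realType) (d : nat) (hd : d = 2%N \/ d = 3%N)
    (Omega : set 'rV[R]_d) (hOmega : convex_polyhedral_domain Omega)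
    (A : 'rV[R]_d -> 'M[R]_d) (c C : R) (hc : 0 < c) (hC : 0 < C)
    (hA : elliptic_coefficient Omega A c C)
    (T : mesh R d) (hT : triangulation T Omega)
    (sigma tau : R) (hsigma : shape_regular T sigma) (htau : quasi_uniform T tau)
    (r t : nat) (ht : t = r \/ t = r.+1)
    (gradw : wg_function R d -> {set 'I_(nb_vertices T)} -> 'rV[R]_d -> 'rV[R]_d)
    (hgradw : discrete_weak_gradient Omega r t gradw)
    (Nh : nat) (hNh : has_dimension (Vh T Omega r t) Nh.+1)
    (mubar : 'I_Nh.+1 -> R) (lambdabar : 'I_Nh.+1 -> \bar R)
    (ubar : 'I_Nh.+1 -> wg_function R d)
    (heig : discrete_eigenpairs Omega r t gradw A mubar lambdabar ubar)
    (lambda : R) (u : H10 Omega) (hu : exact_eigenpair A lambda u)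
    (i : 'I_Nh.+1)
    (hi : forall j, `|mubar i - lambda^-1| <= `|mubar j - lambda^-1|)
    (E : wg_function R d -> wg_function R d)
    (hE : spectral_projector Omega r t gradw A (ubar i) E)
    (delta : R)
    (hdelta : is_minimum [set `|mubar j - lambda^-1| | j in [set j | j != i]] delta)
    (hdelta0 : 0 < delta)
    (Qu Pu : wg_function R d)
    (hQ : is_Qh T r t u Qu) (hP : is_Ph r t gradw A lambda u Pu) :
  norm_ah gradw A (Qu - E Qu) <=
    2 * norm_ah gradw A (Qu - Pu) +
    Num.sqrt (mubar ord0) / delta * norm_bh T (Qu - Pu) /\
  norm_bh T (Qu - E Qu) <=
    (2 + mubar ord0 / delta) * norm_bh T (Qu - Pu).
Proof.
have d_gt0 : (0 < d)%N by case: hd => ->.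
have [Vubar bu au lamE [lam_gt0 lam_le]] := heig.
have [VQu _ _] := hQ; have [VPu PuE] := hP.
have [_ lbd] := hdelta; have [Ek Ea] := hE _ VQu.
(* The normalization [a_form A u u = 1] excludes a zero eigenvalue. *)
have lambda0 : lambda != 0.
  have [a1 aE] := hu; apply/eqP => l0; have := aE u.
  by rewrite a1 l0 mul0r => /eqP; rewrite oner_eq0.
have V0 := Vh0 T Omega r t.
have VD k x y := @Vh_lin _ _ T Omega r t k x y.
have aD k x y z := @ah_lin _ _ _ _ d_gt0 hT _ _ _ hgradw _ _ _ hc hA k x y z.
have bD k x y z := @bh_lin _ _ _ _ hT r t k x y z.
have aC x y := fun (_ : Vh T Omega r t x) (_ : Vh T Omega r t y) =>
  ahC hT gradw hA x y.
have bC x y := fun (_ : Vh T Omega r t x) (_ : Vh T Omega r t y) => bhC T x y.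
have gap j : j != i -> delta <= `|mubar j - lambda^-1|.
  by move=> ji; apply: lbd; exists j.
(* The projection identity replaces [u] by [Qu] in the equation defining [Pu], which then involves
   only elements of [Vh]. *)
have pq v (Vv : Vh T Omega r t v) : ah gradw A Pu v = lambda * bh T Qu v.
  by rewrite PuE// (bh_L2_Qh hT hQ).
have mu0 := mubar_ge0 lamE lam_gt0.
have mu_le := mubar_le_first lamE lam_gt0 lam_le.
split.
- exact: (spectral_estimate_a V0 VD aD bD aC bC Vubar au bu hNh lambda0 hdelta0
    mu0 mu_le gap VQu VPu pq Ek Ea).
- exact: (spectral_estimate_b V0 VD aD bD aC bC Vubar au bu hNh lambda0 hdelta0
    mu0 mu_le gap VQu VPu pq Ek Ea).
Qed.
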